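(* Let $\Phi=(G,\varphi)$ be a finite complex unit gain graph of order $n$ (without loops and multiple edges). Then $r(\Phi)=r(G)+2\theta(G)$ if and only if all of the following hold: (i) the cycles (if any) of $G$ are pairwise vertex-disjoint; (ii) each cycle $C_p^{\varphi}$ of $\Phi$ is of Type B and has order $p\equiv 0 \pmod 4$; (iii) a series of $\delta$-transformations can transform $G$ into a crucial subgraph $G_0$ that is the disjoint union of $\theta(G)$ cycles together with some isolated vertices.
   Context: A complex unit gain graph $\Phi=(G,\varphi)$ consists of a finite simple graph $G$ (the underlying graph) with vertex set $\{v_1,\dots,v_n\}$ and a gain function $\varphi$ assigning to each oriented edge $e_{ij}$ (from $v_i$ to $v_j$, where $v_iv_j\in E(G)$) a complex number of modulus $1$, with $\varphi(e_{ji})=\overline{\varphi(e_{ij})}$. The adjacency matrix $A(\Phi)$ is the Hermitian matrix with $(i,j)$ entry $\varphi(e_{ij})$ if $v_iv_j\in E(G)$ and $0$ otherwise; $r(\Phi)$ is its rank, and $r(G)$ is the rank of the $0$-$1$ adjacency matrix of $G$. $\theta(G)=|E(G)|-|V(G)|+\omega(G)$, where $\omega(G)$ is the number of connected components. Subgraphs of $\Phi$ carry the gains of $\Phi$; a cycle $C_p^\varphi$ of $\Phi$ is a cycle of $G$ with its gains. For a gain cycle $C_p^{\varphi}$ with vertices $v_1,\dots,v_p$ in cyclic order, $\varphi(C_p)=\varphi(e_{12})\varphi(e_{23})\cdots\varphi(e_{p1})$; for $p$ even it is of Type B if $\varphi(C_p)\neq(-1)^{p/2}$. A $\delta$-transformation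 of a graph with a pendant vertex (vertex of degree $1$) deletes a pendant vertex together with its unique neighbour. A crucial subgraph of $G$ is a graph without pendant vertices obtained from $G$ by a series of $\delta$-transformations. *)

(* Defs.v *)
From HB Require Import structures.
From mathcomp Require Import all_boot all_order all_algebra.
From mathcomp Require Import complex.
From mathcomp Require Import reals.
Set Implicit Arguments. Unset Strict Implicit. Unset Printing Implicit Defensive.
Import Order.TTheory GRing.Theory Num.Theory.
Local Open Scope ring_scope.

Definition simple_graph (n : nat) (e : rel 'I_n) : Prop :=
  irreflexive e /\ symmetric e.

Definition unit_gain (R : realType) (n : nat) (e : rel 'I_n)
  (phi : 'I_n -> 'I_n -> R[i]) : Prop :=
  forall i j, e i j -> `|phi i j| = 1 /\ phi j i = (phi i j)^*.

Definition gain_adj (R : realType) (n : nat) (e : rel 'I_n)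
  (phi : 'I_n -> 'I_n -> R[i]) : 'M[R[i]]_n :=
  \matrix_(i, j) (if e i j then phi i j else 0).

Definition adj01 (R : realType) (n : nat) (e : rel 'I_n) : 'M[R]_n :=
  \matrix_(i, j) (if e i j then 1 else 0).

Definition nedges (n : nat) (e : rel 'I_n) : nat :=
  #|[set p : 'I_n * 'I_n | e p.1 p.2 && (p.1 < p.2)%N]|.

Definition ncomp (n : nat) (e : rel 'I_n) : nat :=
  n_comp (connect e) [pred _ : 'I_n | true].

(* theta(G) = |E| - |V| + omega  (always >= 0, so nat subtraction is exact) *)
Definition theta (n : nat) (e : rel 'I_n) : nat :=
  (nedges e + ncomp e - n)%N.

Definition is_cycle (n : nat) (e : rel 'I_n) (s : seq 'I_n) : bool :=
  [&& uniq s, (2 < size s)%N & cycle e s].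

Definition cyc_adj (n : nat) (s : seq 'I_n) (x y : 'I_n) : bool :=
  (x \in s) && (y \in s) && ((y == next s x) || (x == next s y)).

Definition cycle_gain (R : realType) (n : nat) (phi : 'I_n -> 'I_n -> R[i])
  (s : seq 'I_n) : R[i] :=
  \prod_(x <- s) phi x (next s x).

Definition typeB (R : realType) (n : nat) (phi : 'I_n -> 'I_n -> R[i])
  (s : seq 'I_n) : Prop :=
  ~~ odd (size s) /\ cycle_gain phi s <> (-1) ^+ (size s)./2.

Definition deg_in (n : nat) (e : rel 'I_n) (S : {set 'I_n}) (x : 'I_n) : nat :=
  #|[set y in S | e x y]|.

(* one delta-transformation on the induced subgraph G[S]: delete a pendant
   vertex u together with its unique neighbour v *)
Definition delta_step (n : nat) (e : rel 'I_n) (S S' : {set 'I_n}) : Prop :=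
  exists u v, [/\ u \in S, v \in S, e u v, deg_in e S u = 1%N &
                  S' = S :\ u :\ v].

Inductive delta_star (n : nat) (e : rel 'I_n) : {set 'I_n} -> {set 'I_n} -> Prop :=
| delta_refl S : delta_star e S S
| delta_next S S' S'' : delta_step e S S' -> delta_star e S' S'' ->
    delta_star e S S''.

Definition no_pendant (n : nat) (e : rel 'I_n) (S : {set 'I_n}) : Prop :=
  forall x, x \in S -> deg_in e S x <> 1%N.

(* Main.v *)
Require Import Defs.
From mathcomp Require Import all_boot all_order all_algebra.
From mathcomp Require Import complex.
From mathcomp Require Import reals.
From mathcomp Require Import boolp zify ring.
Set Implicit Arguments. Unset Strict Implicit. Unset Printing Implicit Defensive.
Import Order.TTheory GRing.Theory Num.Theory.
Local Open Scope ring_scope.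

(* Call [w : V -> V -> F] a gain function when w x y * w y x = 1, and compare the
   ranks of G under two gain functions [w] and [v] over arbitrary fields; the theorem
   is the case of a unit gain against the constant 1.

   Deleting a vertex changes a rank by at most 2, deleting a pendant vertex with its
   neighbour lowers both ranks by exactly 2, and deleting a vertex of a cycle lowers
   theta; since both ranks agree on forests, rank w <= rank v + 2 theta.  When equality
   holds, deleting a vertex of a cycle must lower theta by exactly 1 (so the cycles are
   disjoint), keep rank v and lower rank w by 2, and it preserves equality, as does
   every delta-transformation.  Isolating a cycle by such deletions and solving the
   kernel equations around it determines the gains of the cycle.

   It remains to see that in the equality case a graph without pendant vertices has no
   bridge.  Otherwise some bridge xy has x on a cycle.  Since deleting x keeps rank v,
   some null vector for [v] is nonzero at x; the cycles being even, it can be cut down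
   to the colour class of x and to the side of x, which shows that deleting y lowers
   rank v by 2.  Hence the graph minus y still attains equality with the same theta,
   rank w drops by 2, and some null vector z of the graph minus y for [w] is nonzero at
   a neighbour of y.  Among the edges meeting the support of z only y can be a dead end,
   so the support meets a cycle; but z vanishes on cycles, because deleting a vertex of
   a cycle lowers rank w by 2. *)

(** * Deleting edges and vertices *)

Lemma rel_witness_or_empty (T : finType) (r : rel T) :
  (exists x y, r x y) \/ (forall x y, ~~ r x y).
Proof.
have [[x y] rxy | r0] := pickP (fun p : T * T => r p.1 p.2); first by left; exists x, y.
by right=> x y; rewrite (r0 (x, y)).
Qed.

Section GraphOperations.
Local Open Scope nat_scope.
Variable n : nat.
Implicit Types (e f : rel 'I_n) (x y : 'I_n) (S : {set 'I_n}).

Definition del_edge e x y : rel 'I_n :=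
  fun a b => [&& e a b, (a, b) != (x, y) & (a, b) != (y, x)].

Definition del_vertex e x : rel 'I_n := fun a b => [&& e a b, a != x & b != x].

Definition induced e S : rel 'I_n := fun a b => [&& e a b, a \in S & b \in S].

Definition pendant e x y := e x y && [forall z, e x z ==> (z == y)].

Definition pendant_free e := [forall x, forall y, ~~ pendant e x y].

Lemma simple_sym e : simple_graph e -> symmetric e.
Proof. by case. Qed.

Lemma simple_neq e x y : simple_graph e -> e x y -> x != y.
Proof. by case=> irr_e _; apply: contraTneq => ->; rewrite irr_e. Qed.

Lemma simple_connect_sym e : simple_graph e -> connect_sym e.
Proof. by move/simple_sym/sym_connect_sym. Qed.

Lemma simple_del_edge e x y : simple_graph e -> simple_graph (del_edge e x y).
Proof.
case=> irr_e sym_e; split=> [a | a b]; rewrite /del_edge ?irr_e // sym_e !xpair_eqE.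
by rewrite [(b == x) && _]andbC [(b == y) && _]andbC [X in _ && X]andbC.
Qed.

Lemma simple_del_vertex e x : simple_graph e -> simple_graph (del_vertex e x).
Proof.
case=> irr_e sym_e; split=> [a | a b]; rewrite /del_vertex ?irr_e // sym_e.
by rewrite [X in _ && X]andbC.
Qed.

Lemma simple_induced e S : simple_graph e -> simple_graph (induced e S).
Proof.
case=> irr_e sym_e; split=> [a | a b]; rewrite /induced ?irr_e // sym_e.
by rewrite [X in _ && X]andbC.
Qed.

Lemma sub_del_edge e x y : subrel (del_edge e x y) e.
Proof. by move=> a b /and3P[]. Qed.

Lemma sub_del_vertex e x : subrel (del_vertex e x) e.
Proof. by move=> a b /and3P[]. Qed.

Lemma sub_induced e S : subrel (induced e S) e.
Proof. by move=> a b /and3P[]. Qed.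

Lemma induced_setT e : induced e setT = e.
Proof. by apply/funeq2P => a b; rewrite /induced !inE !andbT. Qed.

Lemma del_edgeC e x y : del_edge e x y = del_edge e y x.
Proof. by apply/funeq2P => a b; rewrite /del_edge [X in _ && X]andbC. Qed.

Lemma subrel_del_edge e f x y : subrel f e -> ~~ f x y -> ~~ f y x ->
  subrel f (del_edge e x y).
Proof.
move=> sub_fe f'xy f'yx a b fab; rewrite /del_edge sub_fe //=.
by apply/andP; split; [apply: contraNneq f'xy | apply: contraNneq f'yx] => -[<- <-].
Qed.

Lemma del_edge_id e x y : symmetric e -> ~~ e x y -> del_edge e x y = e.
Proof.
move=> sym_e e'xy; apply/funeq2P => a b; apply/idP/idP; first exact: sub_del_edge.
by apply: subrel_del_edge => //; rewrite sym_e.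
Qed.

Lemma del_vertex_sub_del_edge e x y : subrel (del_vertex e x) (del_edge e x y).
Proof.
by apply: subrel_del_edge (@sub_del_vertex _ _) _ _; rewrite /del_vertex eqxx ?andbF.
Qed.

Lemma connect_subrel e f : subrel e f -> subrel (connect e) (connect f).
Proof. by move=> sub_ef; apply: connect_sub => a b /sub_ef; apply: connect1. Qed.

Lemma pendantP e x y : reflect (e x y /\ forall z, e x z -> z = y) (pendant e x y).
Proof.
apply: (iffP andP) => -[exy uniq_nbr]; split=> //.
  by move=> z exz; apply/eqP/(implyP (forallP uniq_nbr z)).
by apply/forallP => z; apply/implyP => /uniq_nbr->.
Qed.

Lemma pendant_freeP e :
  reflect (forall v w, e v w -> exists2 w', e v w' & w' != w) (pendant_free e).
Proof.
apply: (iffP idP) => [/forallP pendfree v w evw | two_nbrs].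
  have /forallP/(_ w) := pendfree v; rewrite negb_and evw negb_forall.
  by case/existsP=> w'; rewrite negb_imply => /andP[evw' neq_w']; exists w'.
apply/forallP => x; apply/forallP => y; apply/negP => /pendantP[exy uniq_nbr].
by have [z /uniq_nbr-> /eqP] := two_nbrs x y exy.
Qed.

Lemma pendant_freePn e : reflect (exists x y, pendant e x y) (~~ pendant_free e).
Proof.
rewrite negb_forall; apply: (iffP existsP) => -[x].
  by case/forallPn=> y; rewrite negbK => pend_xy; exists x, y.
by case=> y pend_xy; exists x; apply/forallPn; exists y; rewrite negbK.
Qed.

End GraphOperations.

(** * The cyclomatic number *)

Section CyclomaticNumber.
Local Open Scope nat_scope.
Variable n : nat.
Implicit Types (e f : rel 'I_n) (x y : 'I_n).

Definition nonbridge e x y := e x y && connect (del_edge e x y) x y.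

Definition acyclic e := [forall x, forall y, ~~ nonbridge e x y].

Lemma acyclicPn e : reflect (exists x y, nonbridge e x y) (~~ acyclic e).
Proof.
rewrite negb_forall; apply: (iffP existsP) => -[x].
  by case/forallPn=> y; rewrite negbK => nb; exists x, y.
by case=> y nb; exists x; apply/forallPn; exists y; rewrite negbK.
Qed.

Lemma acyclic_bridge e x y : acyclic e -> ~~ nonbridge e x y.
Proof. by move/forallP/(_ x)/forallP. Qed.

Lemma nonbridge_sym e x y : simple_graph e -> nonbridge e x y -> nonbridge e y x.
Proof.
move=> simple_e /andP[exy con_xy]; rewrite /nonbridge (simple_sym simple_e) exy.
by rewrite del_edgeC (simple_connect_sym (simple_del_edge _ _ simple_e)).
Qed.

Lemma sub_nonbridge e f : subrel e f -> subrel (nonbridge e) (nonbridge f).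
Proof.
move=> sub_ef x y /andP[exy con_xy]; rewrite /nonbridge sub_ef //=.
apply: connect_subrel con_xy => a b /and3P[eab neq_ab_xy neq_ab_yx].
by rewrite /del_edge sub_ef // neq_ab_xy.
Qed.

Lemma sub_acyclic e f : subrel e f -> acyclic f -> acyclic e.
Proof.
move=> sub_ef; apply: contraTT => /acyclicPn[x [y nb]].
by apply/acyclicPn; exists x, y; apply: sub_nonbridge nb.
Qed.

Lemma nedges_del_edge e x y : simple_graph e -> e x y ->
  nedges e = (nedges (del_edge e x y)).+1.
Proof.
move=> simple_e; wlog lt_xy : x y / x < y.
  move=> ordered exy; have := simple_neq simple_e exy; rewrite neq_ltn.
  case/orP=> [lt_xy | lt_yx]; first exact: ordered.
  by rewrite del_edgeC; apply: ordered; rewrite // (simple_sym simple_e).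
move=> exy; rewrite /nedges (cardsD1 (x, y)) !inE /= exy lt_xy add1n; congr _.+1.
apply: eq_card => -[a b]; rewrite !inE /= /del_edge andbCA -!andbA; congr (_ && _).
case: (ltnP a b) => [lt_ab | _]; rewrite ?andbF // !andbT.
suff -> : (a, b) != (y, x) by rewrite andbT.
by apply: contraTneq lt_ab => -[-> ->]; rewrite -leqNgt ltnW.
Qed.

Lemma nedges_del_vertex e x y : simple_graph e -> e x y ->
  nedges (del_vertex e x) < nedges e.
Proof.
move=> simple_e exy; rewrite (nedges_del_edge simple_e exy) ltnS.
apply/subset_leq_card/subsetP => -[a b]; rewrite !inE /=.
by case/andP=> /(@del_vertex_sub_del_edge _ _ _ y)-> ->.
Qed.

Lemma simple_graph_ind (P : rel 'I_n -> Prop) :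
  (forall e, simple_graph e ->
     (forall f, simple_graph f -> nedges f < nedges e -> P f) -> P e) ->
  forall e, simple_graph e -> P e.
Proof.
move=> step e; have [k] := ubnP (nedges e); elim: k e => // k IHk e lt_e_k simple_e.
apply: step => // f simple_f lt_fe; apply: IHk => //.
exact: leq_trans lt_fe _.
Qed.

Lemma ncompE e : ncomp e = #|[pred x | fingraph.root e x == x]|.
Proof.
rewrite /ncomp (@eq_n_comp _ _ e); last first.
  by move=> a b; apply/idP/idP => [/connect_sub | ]; [apply | apply: connect1].
by apply: eq_card => a; rewrite !inE andbT.
Qed.

Lemma ncomp_del_nonbridge e x y : simple_graph e -> nonbridge e x y ->
  ncomp (del_edge e x y) = ncomp e.
Proof.
move=> simple_e /andP[_ con_xy]; rewrite !ncompE; apply: eq_card => a; rewrite !inE.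
suff eq_con : connect (del_edge e x y) =2 connect e.
  by rewrite /fingraph.root (eq_pick (eq_con a)).
move=> {}a b; apply/idP/idP; first exact/connect_subrel/sub_del_edge.
apply: connect_sub => {}a {}b eab.
have [/eqP[-> ->] // | neq_xy] := boolP ((a, b) == (x, y)).
have [/eqP[-> ->] | neq_yx] := boolP ((a, b) == (y, x)).
  by rewrite (simple_connect_sym (simple_del_edge _ _ simple_e)).
by apply: connect1; rewrite /del_edge eab neq_xy.
Qed.

Lemma connect_del_edge e x y a b : connect e a b ->
  ~~ connect (del_edge e x y) a y ->
  connect (del_edge e x y) a b ||
    connect (del_edge e x y) a x && connect (del_edge e x y) y b.
Proof.
set d := del_edge e x y => /connectP[p path_p ->] con'ay; move: path_p.
elim/last_ind: p => [|p c IHp]; first by rewrite connect0.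
rewrite rcons_path last_rcons; set l := last a p in IHp * => /andP[/IHp reach_l elc].
have [/eqP[eq_l ->] | neq_xy] := boolP ((l, c) == (x, y)).
  by move: reach_l; rewrite eq_l connect0 andbT => /orP[-> | /andP[->]]; rewrite orbT.
have [/eqP[eq_l ->] | neq_yx] := boolP ((l, c) == (y, x)).
  by move: reach_l; rewrite eq_l (negbTE con'ay) => /andP[->].
have con_lc : connect d l c by apply: connect1; rewrite /d /del_edge elc neq_xy.
case/orP: reach_l => [con_al | /andP[-> con_yl]].
  by rewrite (connect_trans con_al con_lc).
by rewrite (connect_trans con_yl con_lc) orbT.
Qed.

(* Apart from the new component of [y], distinct components stay distinct in [e]. *)
Lemma ncomp_del_edge e x y : simple_graph e -> ncomp (del_edge e x y) <= (ncomp e).+1.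
Proof.
move=> simple_e; have sym_d := simple_connect_sym (simple_del_edge x y simple_e).
rewrite !ncompE; set d := del_edge e x y in sym_d *; pose ry := fingraph.root d y.
set roots_d := [pred a | fingraph.root d a == a].
rewrite (cardD1 ry roots_d) -add1n leq_add ?leq_b1 //.
have inj_root : {in [predD1 roots_d & ry] &, injective (fingraph.root e)}.
  move=> a b; rewrite !inE => /andP[a'y /eqP root_a] /andP[b'y /eqP root_b] /eqP.
  rewrite root_connect; last exact: simple_connect_sym.
  have con'y c : c != ry -> fingraph.root d c = c -> connect d y c = false.
    by move=> c'y root_c; rewrite -root_connect // root_c eq_sym; apply: negbTE.
  move/(@connect_del_edge _ x y); rewrite -/d (sym_d a y) !con'y // andbF orbF.
  by move/(_ isT); rewrite -root_connect // root_a root_b => /eqP.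
rewrite -(card_in_imset inj_root); apply/subset_leq_card/subsetP => _ /imsetP[a _ ->].
by rewrite inE root_root //; apply: simple_connect_sym.
Qed.

Lemma leq_nedges_ncomp e : simple_graph e -> n <= nedges e + ncomp e.
Proof.
move: e; apply: simple_graph_ind => e simple_e IHe.
have [[x [y exy]] | edgeless] := rel_witness_or_empty e.
  have := IHe _ (simple_del_edge x y simple_e); have := ncomp_del_edge x y simple_e.
  by rewrite (nedges_del_edge simple_e exy) ltnSn => ? /(_ isT); lia.
rewrite ncompE -[leqLHS]card_ord -[leqLHS]add0n leq_add // subset_leq_card //.
apply/subsetP => x _; rewrite inE eq_sym.
case/connectP: (connect_root e x) => -[_ -> // | y p].
by rewrite /= (negbTE (edgeless x y)).
Qed.

Lemma theta_del_edge e x y : simple_graph e -> theta (del_edge e x y) <= theta e.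
Proof.
move=> simple_e; have [exy | e'xy] := boolP (e x y); last first.
  by rewrite del_edge_id //; apply: simple_sym.
have := ncomp_del_edge x y simple_e.
by rewrite /theta (nedges_del_edge simple_e exy); lia.
Qed.

Lemma theta_del_nonbridge e x y : simple_graph e -> nonbridge e x y ->
  theta e = (theta (del_edge e x y)).+1.
Proof.
move=> simple_e nb; have := leq_nedges_ncomp (simple_del_edge x y simple_e).
have /andP[exy _] := nb.
by rewrite /theta (nedges_del_edge simple_e exy) (ncomp_del_nonbridge simple_e nb); lia.
Qed.

Lemma theta_sub e f : simple_graph e -> simple_graph f -> subrel e f ->
  theta e <= theta f.
Proof.
move=> simple_e; move: f; apply: simple_graph_ind => f simple_f IHf sub_ef.
have [[x [y /andP[fxy e'xy]]] | no_extra] :=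
  rel_witness_or_empty (fun x y => f x y && ~~ e x y).
  have simple_d := simple_del_edge x y simple_f.
  apply: leq_trans (theta_del_edge x y simple_f); apply: (IHf _ simple_d).
    by rewrite (nedges_del_edge simple_f fxy).
  by apply: subrel_del_edge; rewrite // (simple_sym simple_e).
suff -> : e = f by []; apply/funeq2P => a b; apply/idP/idP => [/sub_ef // | fab].
by have := no_extra a b; rewrite fab negbK.
Qed.

Lemma theta_del_vertex e x : simple_graph e -> theta (del_vertex e x) <= theta e.
Proof.
move=> simple_e; apply: theta_sub (@sub_del_vertex _ e x) => //.
exact: simple_del_vertex.
Qed.

Lemma theta_del_vertex_nonbridge e x y : simple_graph e -> nonbridge e x y ->
  theta (del_vertex e x) < theta e.
Proof.
move=> simple_e nb; rewrite (theta_del_nonbridge simple_e nb) ltnS.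
apply: theta_sub (@del_vertex_sub_del_edge _ _ _ _); first exact: simple_del_vertex.
exact: simple_del_edge.
Qed.

Lemma theta_gt0 e x y : simple_graph e -> nonbridge e x y -> 0 < theta e.
Proof. by move=> simple_e /(theta_del_nonbridge simple_e)->. Qed.

End CyclomaticNumber.

(** * Cycles *)

Section Cycles.
Local Open Scope nat_scope.
Variable n : nat.
Implicit Types (e f : rel 'I_n) (x y : 'I_n).
Implicit Types (s t : seq 'I_n) (cs : seq (seq 'I_n)).

Lemma sub_is_cycle e f s : subrel e f -> is_cycle e s -> is_cycle f s.
Proof.
move=> sub_ef /and3P[uniq_s size_s cyc_s].
by rewrite /is_cycle uniq_s size_s (sub_cycle sub_ef).
Qed.

Lemma is_cycle_next e s x : is_cycle e s -> x \in s -> e x (next s x).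
Proof. by case/and3P=> _ _ cyc_s s_x; apply: next_cycle. Qed.

Lemma is_cycle_from_next e f s : is_cycle e s ->
  {in s, forall x, f x (next s x)} -> is_cycle f s.
Proof.
case/and3P=> uniq_s size_s _ next_s; rewrite /is_cycle uniq_s size_s.
exact: cycle_from_next.
Qed.

Lemma is_cycle_inhabited e s : is_cycle e s -> exists x, x \in s.
Proof. by case/and3P=> _; case: s => // x s; exists x; rewrite mem_head. Qed.

Lemma order_next e s x : is_cycle e s -> x \in s -> order (next s) x = size s.
Proof. by case/and3P=> uniq_s _ _ s_x; rewrite (order_cycle (cycle_next uniq_s)). Qed.

Lemma next_next_neq e s x : is_cycle e s -> x \in s -> next s (next s x) != x.
Proof.
move=> cyc_s s_x; have /and3P[_ size_s _] := cyc_s.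
have := orbit_uniq (next s) x; rewrite /orbit (order_next cyc_s s_x).
case: (size s) size_s => [|[|[|k]]] //= _.
by rewrite !inE !negb_or [next s _ == x]eq_sym => /andP[/and3P[]].
Qed.

Lemma is_cycle_ind e s (P : pred 'I_n) x : is_cycle e s -> x \in s -> P x ->
  {in s, forall y, P y -> P (next s y)} -> {in s, forall y, P y}.
Proof.
case/and3P=> uniq_s _ _ s_x Px P_next y.
rewrite -(fconnect_cycle (cycle_next uniq_s) s_x).
case/connectP=> p + ->; elim/last_ind: p => //= p z IHp.
rewrite rcons_path last_rcons => /andP[path_p /eqP <-]; apply: P_next; last exact: IHp.
by rewrite -(fconnect_cycle (cycle_next uniq_s) s_x); apply/connectP; exists p.
Qed.

Lemma is_cycle_del_vertex e s x : is_cycle e s -> x \notin s ->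
  is_cycle (del_vertex e x) s.
Proof.
move=> cyc_s s'x; apply: is_cycle_from_next (cyc_s) _ => y s_y.
rewrite /del_vertex (is_cycle_next cyc_s s_y) /=.
by apply/andP; split; apply: contraNneq s'x => <-; rewrite ?mem_next.
Qed.

Lemma is_cycle_del_vertex_notin e s x : is_cycle (del_vertex e x) s -> x \notin s.
Proof.
by move=> cyc_s; apply/negP => /(is_cycle_next cyc_s)/and3P[_]; rewrite eqxx.
Qed.

Lemma is_cycle_induced e s (S : {set 'I_n}) : is_cycle e s -> {subset s <= S} ->
  is_cycle (induced e S) s.
Proof.
move=> cyc_s sub_sS; apply: is_cycle_from_next (cyc_s) _ => y s_y.
by rewrite /induced (is_cycle_next cyc_s s_y) !sub_sS ?mem_next.
Qed.

Lemma cyc_adjC s x y : cyc_adj s x y = cyc_adj s y x.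
Proof. by rewrite /cyc_adj orbC [(x \in s) && _]andbC. Qed.

Lemma cyc_adj_meml s x y : cyc_adj s x y -> x \in s.
Proof. by case/andP=> /andP[]. Qed.

Lemma cyc_adj_memr s x y : cyc_adj s x y -> y \in s.
Proof. by case/andP=> /andP[]. Qed.

Lemma cyc_adj_next s x : x \in s -> cyc_adj s x (next s x).
Proof. by move=> s_x; rewrite /cyc_adj s_x mem_next s_x eqxx. Qed.

Lemma cyc_adj_edge e s x y : simple_graph e -> is_cycle e s -> cyc_adj s x y -> e x y.
Proof.
move=> simple_e cyc_s /andP[/andP[s_x s_y]] /orP[] /eqP->; first exact: is_cycle_next.
by rewrite (simple_sym simple_e) (is_cycle_next cyc_s).
Qed.

Lemma is_cycle_del_edge e s x y : is_cycle e s -> ~~ cyc_adj s x y ->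
  is_cycle (del_edge e x y) s.
Proof.
move=> cyc_s nadj_xy; apply: is_cycle_from_next (cyc_s) _ => a s_a.
rewrite /del_edge (is_cycle_next cyc_s s_a) /=.
have adj_a := cyc_adj_next s_a.
by apply/andP; split; apply: contraNneq nadj_xy => -[<- <-]; rewrite // cyc_adjC.
Qed.

Lemma is_cycle_nonbridge e s x y : simple_graph e -> is_cycle e s -> cyc_adj s x y ->
  nonbridge e x y.
Proof.
move=> simple_e cyc_s; wlog next_x : x y / y = next s x.
  move=> oriented /[dup] adj_xy /andP[/andP[s_x s_y]] /orP[] /eqP eq_next.
    exact: oriented.
  by apply: nonbridge_sym => //; apply: oriented; rewrite // cyc_adjC.
move=> adj_xy; have [s_x s_y] := (cyc_adj_meml adj_xy, cyc_adj_memr adj_xy).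
rewrite /nonbridge (cyc_adj_edge simple_e cyc_s adj_xy) /=.
rewrite (simple_connect_sym (simple_del_edge _ _ simple_e)).
suff reach_y : {in s, forall z, connect (del_edge e x y) y z} by apply: reach_y.
apply: (is_cycle_ind cyc_s s_y) => // z s_z reach_z.
have [-> | z'x] := eqVneq z x; first by rewrite -next_x.
apply: connect_trans reach_z _; apply: connect1.
rewrite /del_edge (is_cycle_next cyc_s s_z) !xpair_eqE (negbTE z'x) /=.
apply/negP => /andP[/eqP z_y]; rewrite z_y next_x; exact/negP/(next_next_neq cyc_s).
Qed.

Lemma nonbridge_path e x y : simple_graph e -> nonbridge e x y ->
  exists2 p, path (del_edge e x y) x (rcons p y) & is_cycle e (y :: x :: p).
Proof.
move=> simple_e /andP[exy /connectP[p0 path_p0 last_p0]].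
case/shortenP: path_p0 last_p0 => p path_p uniq_p _.
case/lastP: p path_p uniq_p => [_ _ /= eq_yx | p z path_p uniq_p].
  by have := simple_neq simple_e exy; rewrite eq_yx eqxx.
rewrite last_rcons => eq_yz; rewrite -{z}eq_yz in path_p uniq_p; exists p => //.
rewrite /is_cycle cons_uniq -rcons_uniq rcons_cons uniq_p /= (simple_sym simple_e) exy.
rewrite (sub_path (@sub_del_edge _ e x y)) // andbT.
by case: p path_p {uniq_p} => //=; rewrite /del_edge eqxx /= !andbF.
Qed.

Lemma nonbridge_cycle e x y : simple_graph e -> nonbridge e x y ->
  exists2 s, is_cycle e s & cyc_adj s x y.
Proof.
move=> simple_e /(nonbridge_path simple_e)[p _ cyc_p]; exists (y :: x :: p) => //.
by have := cyc_adj_next (mem_head y (x :: p)); rewrite [next _ _]/= eqxx cyc_adjC.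
Qed.

Lemma theta_del_vertex_two_cycles e s t x y : simple_graph e ->
  is_cycle e s -> is_cycle e t -> x \in t -> cyc_adj s x y -> ~~ cyc_adj t x y ->
  (theta (del_vertex e x)).+2 <= theta e.
Proof.
move=> simple_e cyc_s cyc_t t_x adj_s nadj_t.
have simple_d := simple_del_edge x y simple_e.
rewrite (theta_del_nonbridge simple_e (is_cycle_nonbridge simple_e cyc_s adj_s)) ltnS.
have nb_d : nonbridge (del_edge e x y) x (next t x).
  by apply: is_cycle_nonbridge (is_cycle_del_edge _ nadj_t) (cyc_adj_next _).
apply: leq_trans (theta_del_vertex_nonbridge simple_d nb_d); rewrite ltnS.
apply: theta_sub; [exact: simple_del_vertex | exact: (simple_del_vertex _ simple_d) | ].
move=> a b /[dup] /(@del_vertex_sub_del_edge _ _ _ y) dab /and3P[_ a'x b'x].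
by rewrite /del_vertex dab a'x.
Qed.

Definition disjoint_seqs cs := pairwise (fun s t : seq 'I_n => [disjoint s & t]) cs.

Lemma disjoint_seqsP cs : disjoint_seqs cs <->
  (forall i j, i < size cs -> j < size cs -> i <> j ->
     forall x, x \in nth [::] cs i -> x \notin nth [::] cs j).
Proof.
split=> [/(pairwiseP [::]) disj i j lt_i lt_j neq_ij x x_i | disj].
  have [lt_ij | lt_ji | //] := ltngtP i j.
    by rewrite (disjointFr (disj i j lt_i lt_j lt_ij)).
  by rewrite (disjointFl (disj j i lt_j lt_i lt_ji)).
apply/(pairwiseP [::]) => i j lt_i lt_j lt_ij.
apply/pred0P => x /=; apply/negP => /andP[x_i].
by apply/negP; apply: disj x_i => // eq_ij; rewrite eq_ij ltnn in lt_ij.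
Qed.

Lemma disjoint_seqs_meet cs s t x : disjoint_seqs cs -> s \in cs -> t \in cs ->
  x \in s -> x \in t -> s = t.
Proof.
move=> /disjoint_seqsP disj cs_s cs_t s_x t_x.
have [eq_idx | /eqP neq_idx] := eqVneq (index s cs) (index t cs).
  by rewrite -(nth_index [::] cs_s) eq_idx nth_index.
have := disj (index s cs) (index t cs) _ _ neq_idx x.
by rewrite !index_mem !nth_index // t_x => /(_ cs_s cs_t s_x).
Qed.

End Cycles.

Section DeadEnds.
Variable n : nat.
Implicit Types (e : rel 'I_n) (x y v w : 'I_n) (s : seq 'I_n) (B : {set 'I_n}).

Definition no_dead_end e B :=
  forall v w, v \notin B -> e v w -> exists2 w', e v w' & w' != w.

Definition connected_set e B := {in B &, forall a b, connect (induced e B) a b}.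

Lemma pendant_free_no_dead_end e B : pendant_free e -> no_dead_end e B.
Proof. by move/pendant_freeP=> two_nbrs v w _ /two_nbrs[w' evw' neq_w']; exists w'. Qed.

Lemma connected_set1 e x : connected_set e [set x].
Proof. by move=> a b /set1P-> /set1P->. Qed.

Lemma is_cycle_connected_set e s : is_cycle e s -> connected_set e [set x in s].
Proof.
move=> cyc_s a b; rewrite !inE => s_a s_b; apply: (connect_cycle (p := s)) => //.
have /and3P[_ _] // : is_cycle (induced e [set x in s]) s.
by apply: is_cycle_induced cyc_s _ => x; rewrite inE.
Qed.

Lemma connected_setU1 e B v w : simple_graph e -> connected_set e B ->
  w \in B -> e w v -> connected_set e (v |: B).
Proof.
move=> simple_e con_B B_w ewv a b.
have reach c : c \in v |: B -> connect (induced e (v |: B)) w c.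
  case/setU1P=> [-> | B_c].
    by apply: connect1; rewrite /induced ewv !inE B_w eqxx orbT.
  apply: connect_subrel (con_B w c B_w B_c) => i j /and3P[eij B_i B_j].
  by rewrite /induced eij !inE B_i B_j !orbT.
move=> /reach con_wa /reach; apply: connect_trans.
by rewrite (simple_connect_sym (simple_induced _ simple_e)).
Qed.

Lemma nonbridge_reentry e B v w w' : simple_graph e -> connected_set e B ->
  v \notin B -> e v w -> w \in B -> e v w' -> w' \in B -> w' != w -> nonbridge e v w'.
Proof.
move=> simple_e con_B B'v evw B_w evw' B_w' w'_w; rewrite /nonbridge evw' /=.
have v_w' : v != w' by apply: contraNneq B'v => ->.
apply: (@connect_trans _ _ w).
  by apply: connect1; rewrite /del_edge evw !xpair_eqE eqxx eq_sym w'_w (negbTE v_w').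
apply: connect_subrel (con_B w w' B_w B_w'); apply: subrel_del_edge.
- exact: sub_induced.
- by rewrite /induced (negbTE B'v) !andbF.
- by rewrite /induced (negbTE B'v) !andbF.
Qed.

(* Grow [B] along the edges leaving it; the walk must eventually return to it. *)
Lemma no_dead_end_nonbridge e B v w : simple_graph e -> connected_set e B ->
  no_dead_end e B -> w \in B -> v \notin B -> e w v ->
  exists x y, x \notin B /\ nonbridge e x y.
Proof.
move=> simple_e; have [k] := ubnP #|~: B|.
elim: k B v w => // k IHk B v w lt_B_k con_B live B_w B'v ewv.
have evw : e v w by rewrite (simple_sym simple_e).
have [w' evw' w'_w] := live v w B'v evw.
have [B_w' | B'w'] := boolP (w' \in B).
  by exists v, w'; split=> //; apply: (nonbridge_reentry (w := w)) con_B _ _ _ _ _ _.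
have v_w' := simple_neq simple_e evw'.
have [] := IHk (v |: B) w' v.
- by move: lt_B_k; rewrite (cardsD1 v (~: B)) inE B'v setCU setIC -setDE.
- exact: connected_setU1 con_B B_w ewv.
- by move=> a b; rewrite in_setU1 negb_or => /andP[_]; apply: live.
- exact: setU11.
- by rewrite in_setU1 negb_or eq_sym v_w'.
- by [].
move=> x [y []]; rewrite in_setU1 negb_or => /andP[_ B'x] nb.
by exists x, y.
Qed.

Lemma pendant_free_edge_nonbridge e a b : simple_graph e -> pendant_free e -> e a b ->
  exists x y, nonbridge e x y.
Proof.
move=> simple_e pendfree eab.
have [|x [y [_ nb]]] := no_dead_end_nonbridge simple_e (@connected_set1 e a)
  (pendant_free_no_dead_end pendfree) (set11 a) _ eab; last by exists x, y.
by rewrite inE eq_sym (simple_neq simple_e eab).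
Qed.

Lemma bridge_at_cycle e a b : simple_graph e -> pendant_free e -> e a b ->
  ~~ nonbridge e a b ->
  exists x y x', [/\ e x y, ~~ nonbridge e x y & nonbridge e x x'].
Proof.
move=> simple_e pendfree eab bridge_ab.
pose on_cycle x := [exists x', nonbridge e x x'].
have [[x [y /and3P[/existsP[x' nb] exy bridge_xy]]] | no_exit] :=
  rel_witness_or_empty (fun x y => [&& on_cycle x, e x y & ~~ nonbridge e x y]).
  by exists x, y, x'.
(* Otherwise [on_cycle] is closed under adjacency, and the vertices off the cycles
   induce a graph without dead ends, hence with a cycle. *)
have on_cycle_edge x y : on_cycle x -> e x y -> nonbridge e x y.
  by move=> on_x exy; have := no_exit x y; rewrite on_x exy negbK.
have off_nbr x y : ~~ on_cycle x -> e x y -> ~~ on_cycle y.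
  move=> off_x exy; apply: contra off_x => on_y; apply/existsP; exists y.
  by apply: nonbridge_sym => //; apply: on_cycle_edge; rewrite // (simple_sym simple_e).
have off_a : ~~ on_cycle a by apply: contra bridge_ab => on_a; apply: on_cycle_edge.
pose d := induced e [set x | ~~ on_cycle x].
have simple_d : simple_graph d := simple_induced _ simple_e.
have pendfree_d : pendant_free d.
  apply/pendant_freeP => x y /and3P[exy]; rewrite inE => off_x _.
  have [y' exy' y'_y] := (pendant_freeP _ pendfree) x y exy.
  by exists y'; rewrite // /d /induced exy' !inE off_x (off_nbr x).
have dab : d a b by rewrite /d /induced eab !inE off_a (off_nbr a).
have [x [y nb]] := pendant_free_edge_nonbridge simple_d pendfree_d dab.
have /andP[/and3P[_]] := nb; rewrite inE => /existsP[]; exists y.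
exact: sub_nonbridge (@sub_induced _ _ _) _ _ nb.
Qed.

End DeadEnds.

Section TwoColouring.
Variable n : nat.
Implicit Types (e : rel 'I_n) (col : 'I_n -> bool) (x y : 'I_n).

Definition two_colouring e col := forall x y, e x y -> col x != col y.

Lemma two_colouring_last e col x p : two_colouring e col -> path e x p ->
  col (last x p) = col x (+) odd (size p).
Proof.
move=> col_e; elim: p x => [|y p IHp] x /=; first by rewrite addbF.
case/andP=> /col_e; rewrite -[odd _ in RHS]negbK /= => exy /IHp->.
by move: exy; case: (col x); case: (col y); case: (odd _).
Qed.

Lemma two_colouring_exists e : simple_graph e ->
  (forall s, is_cycle e s -> ~~ odd (size s)) -> exists col, two_colouring e col.
Proof.
move: e; apply: simple_graph_ind => e simple_e IHe even_e.
have [[x [y exy]] | edgeless] := rel_witness_or_empty e; last first.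
  by exists predT => x y exy; have := edgeless x y; rewrite exy.
set d := del_edge e x y; have simple_d : simple_graph d := simple_del_edge x y simple_e.
have [||col col_d] := IHe d simple_d; first by rewrite (nedges_del_edge simple_e exy).
  by move=> s /(sub_is_cycle (@sub_del_edge _ e x y)); apply: even_e.
(* Swap the colours of the component of [y] if necessary. *)
pose flip := (col x == col y) && ~~ connect d y x.
pose col' z := col z (+) (flip && connect d y z).
have col'_xy : col' x != col' y.
  rewrite /col' /flip connect0; have [con_yx | con'yx] := boolP (connect d y x).
    rewrite andbF !addbF; have nb : nonbridge e x y.
      by rewrite /nonbridge exy -/d (simple_connect_sym simple_d).
    have [p path_p /even_e] := nonbridge_path simple_e nb.
    have := two_colouring_last col_d path_p.
    rewrite last_rcons size_rcons /= negbK => ->.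
    by move=> /negbTE->; case: (col x).
  by rewrite andbT andbF addbF; case: (col x); case: (col y).
exists col' => a b eab.
have [/eqP[-> ->] // | neq_xy] := boolP ((a, b) == (x, y)).
have [/eqP[-> ->] | neq_yx] := boolP ((a, b) == (y, x)); first by rewrite eq_sym.
have dab : d a b by rewrite /d /del_edge eab neq_xy.
rewrite /col' (same_connect_r (simple_connect_sym simple_d) (connect1 dab)).
by move: (col_d a b dab); case: (col a); case: (col b); case: (_ && _).
Qed.

End TwoColouring.

(** * Rank of a matrix after erasing a row and a column *)

Section EraseCoordinate.
Variables (F : fieldType) (n : nat).
Implicit Types (A : 'M[F]_n) (z : 'rV[F]_n) (x : 'I_n).

Local Notation unit_row x := (delta_mx 0%R x : 'rV[F]_n).

Definition erase_mx x : 'M[F]_n := diag_mx (\row_i (i != x)%:R).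

Definition null_at m (B : 'M[F]_(n, m)) x := exists2 z : 'rV_n, z *m B = 0 & z 0 x != 0.

Definition spike A x z :=
  [/\ z 0 x = 0, (z *m A) 0 x != 0 & forall j, j != x -> (z *m A) 0 j = 0].

Definition spike_at A x := exists z, spike A x z.

Lemma mul_mx_erase m (B : 'M[F]_(m, n)) x i j :
  (B *m erase_mx x) i j = B i j * (j != x)%:R.
Proof. by rewrite mul_mx_diag !mxE. Qed.

Lemma mul_erase_mx m (B : 'M[F]_(n, m)) x i j :
  (erase_mx x *m B) i j = (i != x)%:R * B i j.
Proof. by rewrite mul_diag_mx !mxE. Qed.

Lemma mul_row_erase z x : z 0 x = 0 -> z *m erase_mx x = z.
Proof.
move=> z_x; apply/rowP => j; rewrite mul_mx_erase.
by case: eqP => [-> | _]; rewrite ?z_x ?mulr0 ?mulr1.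
Qed.

Lemma tr_erase_mx x : (erase_mx x)^T = erase_mx x.
Proof. exact: tr_diag_mx. Qed.

Lemma kermx_erase x : (kermx (erase_mx x) :=: unit_row x)%MS.
Proof.
apply/eqmxP/andP; split; last first.
  apply/sub_kermxP/rowP => j; rewrite mul_mx_erase !mxE.
  by case: (j == x); rewrite ?andbF ?mulr0 ?mul0r.
apply/rV_subP => z /sub_kermxP/rowP z_erase; apply/sub_rVP; exists (z 0 x).
apply/rowP => j; have := z_erase j; rewrite mul_mx_erase !mxE /=.
by case: eqP => [-> | _]; rewrite ?mulr1 ?mulr0.
Qed.

Lemma mxrank_mul_erase m (B : 'M[F]_(m, n)) x :
  (\rank (B *m erase_mx x) + (unit_row x <= B)%MS)%N = \rank B.
Proof.
rewrite -[RHS](mxrank_mul_ker B (erase_mx x)); congr addn.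
rewrite (cap_eqmx (eqmx_refl B) (kermx_erase x)).
have [] := mxrank_leqif_sup (capmxSr B (unit_row x)).
by rewrite sub_capmx submx_refl andbT mxrank_delta; case: (\rank _) => [|[]] // _ <-.
Qed.

Lemma mxrank_erase_mul m (B : 'M[F]_(n, m)) x :
  (\rank (erase_mx x *m B) + (unit_row x <= B^T)%MS)%N = \rank B.
Proof.
by rewrite -mxrank_tr trmx_mul tr_erase_mx mxrank_mul_erase mxrank_tr.
Qed.

Lemma null_atP m (B : 'M[F]_(n, m)) x :
  reflect (null_at B x) (~~ (unit_row x <= B^T)%MS).
Proof.
apply: (iffP idP) => [ | [z zB z_x]].
  rewrite submxE => /rV0Pn[j]; rewrite -rowE mxE => coker_j.
  exists (col j (cokermx B^T))^T; last by rewrite 2!mxE.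
  by apply: trmx_inj; rewrite trmx_mul trmxK colE mulmxA mulmx_coker mul0mx trmx0.
apply: contra z_x => /submxP[y def_delta].
have /(congr1 (fun v : 'M_1 => v 0 0)) : z *m (delta_mx 0 x)^T = 0 :> 'M_1.
  by rewrite def_delta trmx_mul trmxK mulmxA zB mul0mx.
by rewrite trmx_delta -colE !mxE => ->.
Qed.

Lemma spike_atP A x : reflect (spike_at A x) (unit_row x <= erase_mx x *m A)%MS.
Proof.
apply: (iffP submxP) => [[y def_delta] | [z [z_x zA_x zA_off]]].
  exists (y *m erase_mx x); rewrite /spike mul_mx_erase eqxx mulr0 -mulmxA -def_delta.
  by split=> // [|j]; rewrite !mxE ?eqxx ?oner_eq0 // => /negbTE->.
exists (((z *m A) 0 x)^-1 *: z); rewrite -scalemxAl mulmxA mul_row_erase //.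
apply/rowP => j; rewrite mxE [RHS]mxE eqxx /=.
by have [-> | /zA_off->] := eqVneq j x; rewrite ?mulVf ?mulr0.
Qed.

Lemma mxrank_erase A x :
  (\rank (erase_mx x *m A *m erase_mx x) + (unit_row x <= A^T)%MS
     + (unit_row x <= erase_mx x *m A)%MS)%N = \rank A.
Proof. by rewrite addnAC mxrank_mul_erase mxrank_erase_mul. Qed.

Lemma mxrank_erase_tr A x :
  \rank (erase_mx x *m A^T *m erase_mx x) = \rank (erase_mx x *m A *m erase_mx x).
Proof. by rewrite -mxrank_tr !trmx_mul trmxK !tr_erase_mx mulmxA. Qed.

Lemma mxrank_erase_le A x : (\rank (erase_mx x *m A *m erase_mx x) <= \rank A)%N.
Proof. by rewrite -(mxrank_erase A x) -addnA leq_addr. Qed.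

Lemma mxrank_erase_ge A x : (\rank A <= (\rank (erase_mx x *m A *m erase_mx x)).+2)%N.
Proof. by rewrite -(mxrank_erase A x); do 2!case: (_ <= _)%MS; lia. Qed.

Lemma mxrank_erase_eqP A x :
  \rank (erase_mx x *m A *m erase_mx x) = \rank A <-> null_at A x /\ null_at A^T x.
Proof.
split=> [rank_eq | [/null_atP null_x]].
  have null_at_x B : \rank (erase_mx x *m B *m erase_mx x) = \rank B -> null_at B x.
    move=> rank_B; apply/null_atP; have := mxrank_erase B x.
    by case: (_ <= B^T)%MS => //=; lia.
  by split; apply: null_at_x; rewrite ?mxrank_erase_tr ?mxrank_tr.
move=> /null_atP; rewrite trmxK => null_tr_x.
have := mxrank_erase A x; rewrite (negbTE null_x) addn0 => <-.
suff /negbTE-> : ~~ (unit_row x <= erase_mx x *m A)%MS by rewrite addn0.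
by apply: contra null_tr_x => /submx_trans; apply; apply: submxMl.
Qed.

Lemma mxrank_erase_drop2P A x :
  \rank A = (\rank (erase_mx x *m A *m erase_mx x)).+2 <->
  spike_at A x /\ spike_at A^T x.
Proof.
split=> [rank_eq | [/spike_atP spike_x]].
  have spike_at_x B :
      \rank B = (\rank (erase_mx x *m B *m erase_mx x)).+2 -> spike_at B x.
    move=> rank_B; apply/spike_atP; have := mxrank_erase B x.
    by do 2!case: (_ <= _)%MS; lia.
  by split; apply: spike_at_x; rewrite ?mxrank_erase_tr ?mxrank_tr.
move=> /spike_atP spike_tr_x; have := mxrank_erase A x; rewrite spike_x => <-.
by rewrite (submx_trans spike_tr_x (submxMl _ _)) !addn1.
Qed.

Lemma mxrank_erase_drop2_null A x z :
  \rank A = (\rank (erase_mx x *m A *m erase_mx x)).+2 -> z *m A = 0 -> z 0 x = 0.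
Proof.
move=> rank_eq zA; apply/eqP/negPn/negP => z_x.
have /null_atP/negbTE not_spike : null_at A x by exists z.
by have := mxrank_erase A x; rewrite rank_eq not_spike; case: (_ <= _)%MS; lia.
Qed.

End EraseCoordinate.

(** * Gain functions over a field *)

Section GainRank.
Local Open Scope nat_scope.
Variables (F : fieldType) (n : nat).
Implicit Types (w : 'I_n -> 'I_n -> F) (e : rel 'I_n) (x y : 'I_n) (z : 'rV[F]_n).

Definition gain_mx w e : 'M[F]_n := \matrix_(i, j) (if e i j then w i j else 0%R).

Definition gain_rank w e := \rank (gain_mx w e).

(* The values of [w] off the edges are irrelevant, so the law may as well hold there. *)
Definition is_gain w := forall x y, (w x y * w y x = 1)%R.

Definition tr_gain w : 'I_n -> 'I_n -> F := fun x y => w y x.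

Lemma is_gain_tr w : is_gain w -> is_gain (tr_gain w).
Proof. by move=> gain_w x y; apply: gain_w. Qed.

Lemma is_gain1 : is_gain (fun _ _ => 1%R).
Proof. by move=> x y; rewrite mulr1. Qed.

Lemma is_gain_neq0 w x y : is_gain w -> w x y != 0%R.
Proof.
move=> gain_w; apply: contra_eqN (gain_w x y) => /eqP->.
by rewrite mul0r eq_sym oner_eq0.
Qed.

Lemma mul_gain_mx w e z j :
  ((z *m gain_mx w e) 0 j = \sum_(i | e i j) z 0 i * w i j)%R.
Proof.
rewrite mxE [RHS]big_mkcond; apply: eq_bigr => i _; rewrite mxE.
by case: (e i j); rewrite ?mulr0.
Qed.

Lemma tr_gain_mx w e : symmetric e -> (gain_mx w e)^T = gain_mx (tr_gain w) e.
Proof. by move=> sym_e; apply/matrixP => i j; rewrite !mxE sym_e. Qed.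

Lemma gain_mx_del_vertex w e x :
  gain_mx w (del_vertex e x) = erase_mx F x *m gain_mx w e *m erase_mx F x.
Proof.
apply/matrixP => i j; rewrite mul_mx_erase mul_erase_mx !mxE /del_vertex.
by case: (e i j); case: (i != x); case: (j != x); rewrite ?(mulr0, mul0r, mulr1, mul1r).
Qed.

Lemma spike_null_del_vertex w e x z : spike (gain_mx w e) x z ->
  (z *m gain_mx w (del_vertex e x) = 0)%R.
Proof.
case=> z_x _ zA_off; apply/rowP => j; rewrite gain_mx_del_vertex !mulmxA.
rewrite (mul_row_erase z_x) mul_mx_erase [RHS]mxE.
by have [-> | /zA_off->] := eqVneq j x; rewrite ?mulr0 ?mul0r.
Qed.

Lemma gain_rank_del_vertex_le w e x : gain_rank w (del_vertex e x) <= gain_rank w e.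
Proof. by rewrite /gain_rank gain_mx_del_vertex mxrank_erase_le. Qed.

Lemma gain_rank_del_vertex_ge w e x :
  gain_rank w e <= (gain_rank w (del_vertex e x)).+2.
Proof. by rewrite /gain_rank gain_mx_del_vertex mxrank_erase_ge. Qed.

Lemma gain_rank_del_vertex_eqP w e x : symmetric e ->
  gain_rank w (del_vertex e x) = gain_rank w e <->
  null_at (gain_mx w e) x /\ null_at (gain_mx (tr_gain w) e) x.
Proof.
move=> sym_e; rewrite /gain_rank gain_mx_del_vertex -tr_gain_mx //.
exact: mxrank_erase_eqP.
Qed.

Lemma gain_rank_del_vertex_drop2P w e x : symmetric e ->
  gain_rank w e = (gain_rank w (del_vertex e x)).+2 <->
  spike_at (gain_mx w e) x /\ spike_at (gain_mx (tr_gain w) e) x.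
Proof.
move=> sym_e; rewrite /gain_rank gain_mx_del_vertex -tr_gain_mx //.
exact: mxrank_erase_drop2P.
Qed.

Lemma gain_rank_del_vertex_drop2_null w e x z :
  gain_rank w e = (gain_rank w (del_vertex e x)).+2 ->
  (z *m gain_mx w e = 0 -> z 0 x = 0)%R.
Proof. by rewrite /gain_rank gain_mx_del_vertex; apply: mxrank_erase_drop2_null. Qed.

Lemma gain_rank_pendant w e x y : simple_graph e -> is_gain w -> pendant e x y ->
  gain_rank w e = (gain_rank w (del_vertex e y)).+2.
Proof.
move=> simple_e gain_w /pendantP[exy uniq_nbr].
have spike_y w' : is_gain w' -> spike_at (gain_mx w' e) y.
  move=> gain_w'; exists (delta_mx 0 x)%R.
  rewrite /spike -rowE !mxE exy is_gain_neq0 //.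
  rewrite [y == x]eq_sym (negbTE (simple_neq simple_e exy)) andbF; split=> // j j_y.
  by rewrite !mxE; case: ifP => // /uniq_nbr j_eq; rewrite j_eq eqxx in j_y.
apply/gain_rank_del_vertex_drop2P; first exact: simple_sym.
by split; apply: spike_y => //; apply: is_gain_tr.
Qed.

Lemma gain_rank_edgeless w e : (forall x y, ~~ e x y) -> gain_rank w e = 0.
Proof.
move=> edgeless; rewrite /gain_rank (_ : gain_mx w e = 0)%R ?mxrank0 //.
by apply/matrixP => i j; rewrite !mxE (negbTE (edgeless i j)).
Qed.

End GainRank.

Section GainRankBound.
Local Open Scope nat_scope.
Variables (F K : fieldType) (n : nat) (w : 'I_n -> 'I_n -> F) (v : 'I_n -> 'I_n -> K).
Hypotheses (gain_w : is_gain w) (gain_v : is_gain v).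
Implicit Types (e : rel 'I_n) (x y : 'I_n).

Lemma gain_rank_acyclic e : simple_graph e -> acyclic e ->
  gain_rank w e = gain_rank v e.
Proof.
move: e; apply: simple_graph_ind => e simple_e IHe acyclic_e.
have [[a [b eab]] | edgeless] := rel_witness_or_empty e.
  have /pendant_freePn[x [y pend_xy]] : ~~ pendant_free e.
    apply/negP => /(pendant_free_edge_nonbridge simple_e) /(_ eab)[x [y]].
    exact/negP/acyclic_bridge.
  rewrite (gain_rank_pendant simple_e gain_w pend_xy).
  rewrite (gain_rank_pendant simple_e gain_v pend_xy).
  have simple_d := simple_del_vertex y simple_e; rewrite IHe //.
    have /pendantP[exy _] := pend_xy; apply: (nedges_del_vertex (y := x)) => //.
    by rewrite (simple_sym simple_e).
  exact: sub_acyclic (@sub_del_vertex _ _ _) acyclic_e.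
by rewrite !gain_rank_edgeless.
Qed.

Lemma gain_rank_le e : simple_graph e -> gain_rank w e <= gain_rank v e + 2 * theta e.
Proof.
move: e; apply: simple_graph_ind => e simple_e IHe.
have [acyclic_e | /acyclicPn[x [y nb]]] := boolP (acyclic e).
  by rewrite gain_rank_acyclic ?leq_addr.
have /andP[exy _] := nb.
have := IHe _ (simple_del_vertex x simple_e) (nedges_del_vertex simple_e exy).
have := theta_del_vertex_nonbridge simple_e nb.
by have := gain_rank_del_vertex_ge w e x; have := gain_rank_del_vertex_le v e x; lia.
Qed.

End GainRankBound.

(** * Rank around a cycle *)

Section CycleType.
Variables (F : fieldType) (n : nat).
Implicit Types (w : 'I_n -> 'I_n -> F) (e : rel 'I_n) (x : 'I_n) (s : seq 'I_n).

Definition cgain w s := \prod_(x <- s) w x (next s x).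

(* For even cycles, the negation of Type B. *)
Definition typeA w s := cgain w s == (-1) ^+ (size s)./2.

Definition cycle_component e s :=
  is_cycle e s /\ forall x y, x \in s -> e x y -> cyc_adj s x y.

Lemma cgain1 s : cgain (fun _ _ => 1) s = 1.
Proof. exact: big1. Qed.

Lemma typeA_tr w s : is_gain w -> typeA (tr_gain w) s = typeA w s.
Proof.
move=> gain_w; have mul_cgain : cgain w s * cgain (tr_gain w) s = 1.
  by rewrite -big_split big1 //= => x _; apply: gain_w.
have sgn_neq0 : (-1) ^+ (size s)./2 != 0 :> F by rewrite signr_eq0.
apply/eqP/eqP => gain_s; move: mul_cgain; rewrite gain_s.
  by rewrite -[RHS](signrMK (size s)./2) mulr1; apply: (mulIf sgn_neq0).
by rewrite -[RHS](signrMK (size s)./2) mulr1; apply: (mulfI sgn_neq0).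
Qed.

Lemma cycle_component_del_vertex e s x : cycle_component e s -> x \notin s ->
  cycle_component (del_vertex e x) s.
Proof.
case=> cyc_s adj_s s'x; split=> [|a b s_a /sub_del_vertex]; last exact: adj_s.
exact: is_cycle_del_vertex.
Qed.

End CycleType.

Section CycleComponent.
Variables (F : fieldType) (n : nat) (e : rel 'I_n) (s : seq 'I_n) (x0 : 'I_n).
Hypotheses (simple_e : simple_graph e) (comp_s : cycle_component e s) (s_x0 : x0 \in s).
Implicit Types (w : 'I_n -> 'I_n -> F) (z : 'rV[F]_n).

Let cyc_s : is_cycle e s := proj1 comp_s.
Let uniq_s : uniq s. Proof. by case/and3P: cyc_s. Qed.
Let size_s : (2 < size s)%N. Proof. by case/and3P: cyc_s. Qed.

Local Notation c i := (iter i (next s) x0).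

Lemma mem_iter_next i : c i \in s.
Proof. by elim: i => //= i IHi; rewrite mem_next. Qed.

Lemma iter_next_size : c (size s) = x0.
Proof.
rewrite -(order_next cyc_s s_x0) iter_order //; exact: can_inj (prev_next uniq_s).
Qed.

Lemma findex_iter_next i : (i < size s)%N -> findex (next s) x0 (c i) = i.
Proof. by move=> lt_i_s; rewrite findex_iter // (order_next cyc_s s_x0). Qed.

Lemma iter_nextP x : x \in s -> exists2 i, (i < size s)%N & x = c i.+1.
Proof.
move=> s_x; have : prev s x \in s by rewrite mem_prev.
rewrite -(fconnect_cycle (cycle_next uniq_s) s_x0) => con_x.
exists (findex (next s) x0 (prev s x)).
  by rewrite -(order_next cyc_s s_x0) findex_max.
by rewrite iterS iter_findex // next_prev.
Qed.

Lemma mul_gain_mx_cycle w z i : (z *m gain_mx w e) 0 (c i.+1) =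
  z 0 (c i) * w (c i) (c i.+1) + z 0 (c i.+2) * w (c i.+2) (c i.+1).
Proof.
have e_next k : e (c k) (c k.+1) by apply: is_cycle_next cyc_s (mem_iter_next k).
rewrite mul_gain_mx (bigD1 (c i)) //= (bigD1 (c i.+2)) /=; last first.
  rewrite (simple_sym simple_e) (e_next i.+1).
  exact: next_next_neq cyc_s (mem_iter_next i).
rewrite big1 ?addr0 // => a /andP[/andP[e_a neq_i] neq_i2].
have : cyc_adj s (c i.+1) a.
  by apply: (proj2 comp_s) (mem_iter_next i.+1) _; rewrite (simple_sym simple_e).
case/andP=> _ /orP[] /eqP eq_next; first by rewrite eq_next eqxx in neq_i2.
by case/eqP: neq_i; apply: can_inj (prev_next uniq_s) _ _ _.
Qed.

Lemma mul_gain_mx_off_cycle w z j : (forall x, x \notin s -> z 0 x = 0) -> j \notin s ->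
  (z *m gain_mx w e) 0 j = 0.
Proof.
move=> z_off s'j; rewrite mul_gain_mx big1 // => i eij.
rewrite z_off ?mul0r //; apply: contra s'j => s_i.
exact: cyc_adj_memr (proj2 comp_s i j s_i eij).
Qed.

Definition walk_gain w k := \prod_(0 <= i < k) w (c i) (c i.+1).

Lemma walk_gainS w k : walk_gain w k.+1 = walk_gain w k * w (c k) (c k.+1).
Proof. exact: big_nat_recr. Qed.

Lemma cgainE w : cgain w s = walk_gain w (size s).
Proof.
have -> : cgain w s = \prod_(x <- orbit (next s) x0) w x (next s x).
  apply: perm_big.
  by rewrite (orbitE (cycle_next uniq_s) uniq_s s_x0) perm_sym perm_rot.
rewrite /orbit (order_next cyc_s s_x0); elim: (size s) => [|k IHk].
  by rewrite big_nil /walk_gain big_geq.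
by rewrite trajectSr big_rcons walk_gainS -IHk.
Qed.

(* Solves the kernel equations at the vertices [c k.+1] from the values [0] at [c 0]
   and [w (c 0) (c 1)] at [c 1]. *)
Definition alternating_gain w k : F :=
  if odd k then (-1) ^+ k./2 * walk_gain w k else 0.

Lemma alternating_gain_kernel w k : is_gain w ->
  alternating_gain w k * w (c k) (c k.+1) +
    alternating_gain w k.+2 * w (c k.+2) (c k.+1) = 0.
Proof.
move=> gain_w; rewrite /alternating_gain /= negbK.
case: (odd k); rewrite ?mul0r ?addr0 // exprS !walk_gainS -!mulrA gain_w mulr1.
by rewrite mulN1r addrN.
Qed.

Definition alternating_vec w : 'rV[F]_n :=
  \row_x (if x \in s then alternating_gain w (findex (next s) x0 x) else 0).

Lemma alternating_vecE w k : ~~ odd (size s) -> (k <= size s)%N ->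
  alternating_vec w 0 (c k) = alternating_gain w k.
Proof.
move=> even_s; rewrite mxE mem_iter_next leq_eqVlt => /orP[/eqP-> | lt_k_s].
  by rewrite iter_next_size findex0 /alternating_gain (negbTE even_s).
by rewrite findex_iter_next.
Qed.

Lemma mul_alternating_vec_off w j : is_gain w -> ~~ odd (size s) -> j != x0 ->
  (alternating_vec w *m gain_mx w e) 0 j = 0.
Proof.
move=> gain_w even_s j_x0; have [s_j | s'j] := boolP (j \in s); last first.
  by apply: mul_gain_mx_off_cycle s'j => x /negbTE s'x; rewrite mxE s'x.
have [i lt_i_s def_j] := iter_nextP s_j; rewrite {}def_j in j_x0 *.
rewrite leq_eqVlt in lt_i_s; case/predU1P: lt_i_s => [size_eq | lt_i1_s].
  by case/eqP: j_x0; rewrite size_eq iter_next_size.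
by rewrite mul_gain_mx_cycle !alternating_vecE ?alternating_gain_kernel // ltnW // ltnW.
Qed.

Lemma mul_alternating_vec_start w : is_gain w -> ~~ odd (size s) ->
  (alternating_vec w *m gain_mx w e) 0 x0 = 1 - (-1) ^+ (size s)./2 * cgain w s.
Proof.
move=> gain_w even_s.
have [i size_eq] : exists i, size s = i.+1 by exists (size s).-1; lia.
have c_last : c i.+1 = x0 by rewrite -size_eq iter_next_size.
have odd_i : odd i by rewrite size_eq negbK in even_s.
have := mul_gain_mx_cycle w (alternating_vec w) i.
rewrite [c i.+2]iterS c_last -[next s x0]/(c 1) => ->.
rewrite !alternating_vecE //; [| by rewrite size_eq | by rewrite size_eq].
rewrite /alternating_gain odd_i cgainE size_eq (walk_gainS w i) c_last.
rewrite [walk_gain w 1]big_nat1 /= expr0 mul1r gain_w uphalf_half odd_i exprS.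
ring.
Qed.

Lemma null_at_cycle w : is_gain w -> ~~ odd (size s) -> typeA w s ->
  null_at (gain_mx w e) (next s x0).
Proof.
move=> gain_w even_s /eqP type_s; exists (alternating_vec w).
  apply/rowP => j; rewrite [RHS]mxE; have [-> | j_x0] := eqVneq j x0.
    by rewrite mul_alternating_vec_start // type_s -expr2 sqrr_sign subrr.
  exact: mul_alternating_vec_off.
rewrite (@alternating_vecE w 1) ?(ltn_trans _ size_s) // /alternating_gain /=.
by rewrite expr0 mul1r walk_gainS /walk_gain big_geq // mul1r is_gain_neq0.
Qed.

Lemma spike_at_cycle w : is_gain w -> ~~ odd (size s) -> ~~ typeA w s ->
  spike_at (gain_mx w e) x0.
Proof.
move=> gain_w even_s type_s; exists (alternating_vec w); split.
- by rewrite (@alternating_vecE w 0).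
- rewrite mul_alternating_vec_start // subr_eq0; apply: contra type_s => /eqP type_s.
  by apply/eqP; rewrite -[LHS](signrMK (size s)./2) -type_s mulr1.
- by move=> j; apply: mul_alternating_vec_off.
Qed.

(* With [z x0 = 0] the kernel equations propagate zeros in steps of two, in both
   directions from [x0], and an odd cycle makes them reach both neighbours of [x0]. *)
Lemma not_spike_at_odd_cycle w : is_gain w -> odd (size s) ->
  ~ spike_at (gain_mx w e) x0.
Proof.
move=> gain_w odd_s [z [z_x0 /eqP + z_off]]; apply.
have z_step k : (k.+1 < size s)%N -> (z 0 (c k) == 0) = (z 0 (c k.+2) == 0).
  move=> lt_k_s; have := mul_gain_mx_cycle w z k; rewrite z_off; last first.
    by apply/eqP => /(congr1 (findex (next s) x0)); rewrite findex_iter_next // findex0.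
  move/esym/eqP; rewrite addr_eq0 => /eqP kernel_eq.
  have w_neq0 i j : w (c i) (c j) != 0 by apply: is_gain_neq0.
  rewrite -[LHS](mulIr_eq0 _ (mulIf (w_neq0 k k.+1))) kernel_eq oppr_eq0.
  by rewrite mulIr_eq0 //; apply/mulIf/(w_neq0 k.+2 k.+1).
have z_even m : (m.*2 <= size s)%N -> z 0 (c m.*2) = 0.
  elim: m => [// | m IHm] le_m_s; apply/eqP; rewrite doubleS -z_step; last by lia.
  by rewrite IHm //; lia.
have z_odd m : (m.*2 < size s)%N -> z 0 (c (size s - m.*2)) = 0.
  elim: m => [|m IHm] lt_m_s; first by rewrite subn0 iter_next_size.
  apply/eqP; rewrite z_step; last by lia.
  by rewrite (_ : (_ - _).+2 = size s - m.*2)%N ?IHm //; lia.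
have size_eq : size s = (size s)./2.*2.+1 by have := odd_double_half (size s); lia.
have c_last : c (size s)./2.*2.+1 = x0 by rewrite -size_eq iter_next_size.
have := mul_gain_mx_cycle w z (size s)./2.*2; rewrite [c _.+2]iterS c_last => ->.
rewrite z_even; last by lia.
have := z_odd (size s)./2; rewrite (_ : (_ - _)%N = 1%N); last by lia.
by rewrite /= => ->; rewrite ?mul0r ?addr0 //; lia.
Qed.

End CycleComponent.

Section CycleComponentRank.
Variables (F : fieldType) (n : nat) (w : 'I_n -> 'I_n -> F).
Variables (e : rel 'I_n) (s : seq 'I_n).
Hypotheses (gain_w : is_gain w) (simple_e : simple_graph e).
Hypothesis comp_s : cycle_component e s.
Implicit Types x : 'I_n.

Let sym_e : symmetric e := simple_sym simple_e.

Lemma gain_rank_del_typeA x : x \in s -> ~~ odd (size s) -> typeA w s ->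
  gain_rank w (del_vertex e x) = gain_rank w e.
Proof.
move=> s_x even_s type_s; have /and3P[uniq_s _ _] := proj1 comp_s.
have s_prev : prev s x \in s by rewrite mem_prev.
apply/gain_rank_del_vertex_eqP; rewrite // -[x](next_prev uniq_s).
have gain_tr := is_gain_tr gain_w.
by split; apply: (null_at_cycle simple_e comp_s); rewrite ?(typeA_tr s gain_w).
Qed.

Lemma gain_rank_del_not_typeA x : x \in s -> ~~ odd (size s) -> ~~ typeA w s ->
  gain_rank w e = (gain_rank w (del_vertex e x)).+2.
Proof.
move=> s_x even_s type_s; apply/gain_rank_del_vertex_drop2P => //.
have gain_tr := is_gain_tr gain_w.
by split; apply: (spike_at_cycle simple_e comp_s); rewrite ?(typeA_tr s gain_w).
Qed.

Lemma gain_rank_drop2_even x : x \in s ->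
  gain_rank w e = (gain_rank w (del_vertex e x)).+2 -> ~~ odd (size s).
Proof.
move=> s_x /(gain_rank_del_vertex_drop2P _ _ sym_e)[spike_x _].
by apply/negP => odd_s; apply: (not_spike_at_odd_cycle simple_e comp_s s_x) spike_x.
Qed.

End CycleComponentRank.

(** * Kernel vectors at bridges *)

Lemma sum_neq0_exists (V : nmodType) (I : finType) (P : pred I) (g : I -> V) :
  \sum_(i | P i) g i != 0 -> exists2 i, P i & g i != 0.
Proof.
move=> sum_neq0; have /exists_inP[i Pi gi] : [exists i in P, g i != 0].
  apply: contraNT sum_neq0 => /exists_inPn g0; apply/eqP/big1 => i Pi.
  by apply/eqP/negPn/g0.
by exists i.
Qed.

Section BridgeKernel.
Variables (F : fieldType) (n : nat) (w : 'I_n -> 'I_n -> F) (e : rel 'I_n).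
Hypotheses (gain_w : is_gain w) (simple_e : simple_graph e).
Implicit Types (x y : 'I_n) (z : 'rV[F]_n) (col : 'I_n -> bool).

Let sym_e : symmetric e := simple_sym simple_e.

(* Restrict a null vector to the colour class of [x] and to its side of the bridge. *)
Lemma bridge_null_at_spike_at col x y :
  two_colouring e col -> e x y -> ~~ nonbridge e x y ->
  null_at (gain_mx w e) x -> spike_at (gain_mx w e) y.
Proof.
move=> col_e exy bridge_xy [z zA z_x]; pose side i := connect (del_edge e x y) x i.
have side'y : ~~ side y by rewrite /nonbridge exy in bridge_xy.
have del_off i j : e i j -> j != y -> (j != x) || (i != y) -> del_edge e x y i j.
  move=> eij j_y; rewrite /del_edge eij !xpair_eqE (negbTE j_y) andbF /=.
  by rewrite negb_and orbC.
pose zx : 'rV[F]_n := \row_i (if side i && (col i == col x) then z 0 i else 0).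
exists zx; split=> [||j j_y]; first by rewrite mxE (negbTE side'y).
  rewrite mul_gain_mx (bigD1 x) //= big1 => [|i /andP[eiy i_x]].
    by rewrite addr0 mxE /side connect0 eqxx mulf_neq0 // is_gain_neq0.
  rewrite mxE (_ : side i = false) ?mul0r //; apply: contraNF side'y => side_i.
  apply: connect_trans side_i _; apply: connect1.
  rewrite /del_edge eiy !xpair_eqE (negbTE i_x).
  by rewrite andbC /= negb_and (simple_neq simple_e eiy).
rewrite mul_gain_mx; have [col_j | col_j] := eqVneq (col j) (col x).
  rewrite big1 // => i /col_e; rewrite col_j mxE => /negbTE->.
  by rewrite andbF mul0r.
have j_x : j != x by apply: contraNneq col_j => ->.
have same_side i : e i j -> side i = side j.
  move=> eij; have dij : del_edge e x y i j by rewrite del_off ?j_x.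
  have sym_d := simple_connect_sym (simple_del_edge x y simple_e).
  exact: (same_connect_r sym_d (connect1 dij)).
have col_i i : e i j -> col i == col x.
  by move/col_e; move: col_j; case: (col i); case: (col j); case: (col x).
have [side_j | side'j] := boolP (side j); last first.
  by rewrite big1 // => i eij; rewrite mxE same_side // (negbTE side'j) mul0r.
transitivity ((z *m gain_mx w e) 0 j); last by rewrite zA mxE.
by rewrite mul_gain_mx; apply: eq_bigr => i eij; rewrite mxE same_side // side_j col_i.
Qed.

(* Among the edges meeting the support of [z], only [y] can be a dead end. *)
Lemma spike_support_nonbridge z y : pendant_free e -> spike (gain_mx w e) y z ->
  exists a b, z 0 a != 0 /\ nonbridge e a b.
Proof.
move=> pendfree [z_y zA_y zA_off].
pose d i j := e i j && ((z 0 i != 0) || (z 0 j != 0)).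
have sub_d : subrel d e by move=> i j /andP[].
have simple_d : simple_graph d.
  by case: simple_e => irr_e _; split=> [i | i j]; rewrite /d ?irr_e // sym_e orbC.
have [x exy] : exists2 x, e x y & z 0 x != 0.
  move: zA_y; rewrite mul_gain_mx => /sum_neq0_exists[x exy].
  by rewrite mulf_eq0 negb_or => /andP[z_x _]; exists x.
move=> z_x; have live : no_dead_end d [set y].
  move=> i j; rewrite inE => i_y /andP[eij z_ij].
  have [z_i | z_i] := eqVneq (z 0 i) 0; last first.
    have [j' eij' j'_j] := pendant_freeP _ pendfree i j eij.
    by exists j'; rewrite // /d eij' z_i.
  rewrite z_i eqxx /= in z_ij; have := zA_off i i_y.
  rewrite mul_gain_mx (bigD1 j) 1?sym_e //= => /eqP.
  rewrite addrC addr_eq0 => /eqP others.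
  have /sum_neq0_exists[j' /andP[ej'i j'_j]] :
      \sum_(k | e k i && (k != j)) z 0 k * w k i != 0.
    by rewrite others oppr_eq0 mulf_neq0 // is_gain_neq0.
  rewrite mulf_eq0 negb_or => /andP[z_j' _].
  by exists j'; rewrite // /d sym_e ej'i z_j' orbT.
have dyx : d y x by rewrite /d sym_e exy z_x orbT.
have x_y : x \notin [set y] by rewrite inE (simple_neq simple_e exy).
have [a [b [_ nb]]] :=
  no_dead_end_nonbridge simple_d (@connected_set1 _ d y) live (set11 y) x_y dyx.
have nb_e := sub_nonbridge sub_d nb; have /andP[/andP[_ /orP[z_a | z_b]] _] := nb.
  by exists a, b.
by exists b, a; split=> //; apply: nonbridge_sym.
Qed.

End BridgeKernel.

(** * Graphs attaining the bound *)

Section Tight.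
Local Open Scope nat_scope.
Variables (F K : fieldType) (n : nat) (w : 'I_n -> 'I_n -> F) (v : 'I_n -> 'I_n -> K).
Hypotheses (gain_w : is_gain w) (gain_v : is_gain v).
Implicit Types (e f : rel 'I_n) (x y : 'I_n) (s t : seq 'I_n) (cs : seq (seq 'I_n)).

Definition tight e := gain_rank w e = gain_rank v e + 2 * theta e.

Lemma tight_del_vertex e x y : simple_graph e -> tight e -> nonbridge e x y ->
  [/\ tight (del_vertex e x), theta e = (theta (del_vertex e x)).+1,
      gain_rank v (del_vertex e x) = gain_rank v e &
      gain_rank w e = (gain_rank w (del_vertex e x)).+2].
Proof.
rewrite /tight => simple_e tight_e nb; have := theta_del_vertex_nonbridge simple_e nb.
have := gain_rank_le gain_w gain_v (simple_del_vertex x simple_e).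
have := gain_rank_del_vertex_ge w e x; have := gain_rank_del_vertex_le v e x.
by split; lia.
Qed.

Lemma tight_del_pendant e x y : simple_graph e -> tight e -> pendant e x y ->
  tight (del_vertex e y) /\ theta (del_vertex e y) = theta e.
Proof.
rewrite /tight => simple_e tight_e pend_xy; have := theta_del_vertex y simple_e.
have := gain_rank_le gain_w gain_v (simple_del_vertex y simple_e).
have := gain_rank_pendant simple_e gain_w pend_xy.
have := gain_rank_pendant simple_e gain_v pend_xy.
by split; lia.
Qed.

Lemma tight_acyclic e : simple_graph e -> acyclic e -> tight e -> theta e = 0.
Proof.
by move=> simple_e /(gain_rank_acyclic gain_w gain_v simple_e); rewrite /tight; lia.
Qed.

Lemma tight_cyc_adj e s t x y : simple_graph e -> tight e ->
  is_cycle e s -> is_cycle e t -> x \in t -> cyc_adj s x y -> cyc_adj t x y.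
Proof.
move=> simple_e tight_e cyc_s cyc_t t_x adj_s; apply/negPn/negP => nadj_t.
have := theta_del_vertex_two_cycles simple_e cyc_s cyc_t t_x adj_s nadj_t.
have nb := is_cycle_nonbridge simple_e cyc_s adj_s.
by have [_ -> _ _] := tight_del_vertex simple_e tight_e nb; rewrite ltnn.
Qed.

Lemma tight_meeting_cycles e s t x : simple_graph e -> tight e ->
  is_cycle e s -> is_cycle e t -> x \in s -> x \in t -> cyc_adj s =2 cyc_adj t.
Proof.
move=> simple_e tight_e; suff sub_adj s' t' : is_cycle e s' -> is_cycle e t' ->
    x \in s' -> x \in t' -> subrel (cyc_adj s') (cyc_adj t').
  by move=> cyc_s cyc_t s_x t_x a b; apply/idP/idP; apply: sub_adj.
move=> cyc_s cyc_t s_x t_x a b adj_s.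
apply: (tight_cyc_adj simple_e tight_e cyc_s cyc_t) => //.
apply: (is_cycle_ind (P := mem t') cyc_s s_x) (cyc_adj_meml adj_s) => // c s_c t_c.
exact: cyc_adj_memr (tight_cyc_adj simple_e tight_e cyc_s cyc_t t_c (cyc_adj_next s_c)).
Qed.

Lemma tight_cycles_disjoint e s t : simple_graph e -> tight e ->
  is_cycle e s -> is_cycle e t -> cyc_adj s =2 cyc_adj t \/ [disjoint s & t].
Proof.
move=> simple_e tight_e cyc_s cyc_t.
have [disj_st | /pred0Pn[x /andP[s_x t_x]]] := boolP [disjoint s & t]; first by right.
by left; apply: (tight_meeting_cycles simple_e tight_e cyc_s cyc_t s_x t_x).
Qed.

Lemma tight_chordless e s x y : simple_graph e -> tight e -> is_cycle e s ->
  x \in s -> y \in s -> e x y -> cyc_adj s x y.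
Proof.
move=> simple_e tight_e cyc_s s_x s_y exy; apply/negPn/negP => nadj_s.
have /and3P[_ _ cyc_d] := is_cycle_del_edge cyc_s nadj_s.
have nb : nonbridge e x y by rewrite /nonbridge exy (connect_cycle cyc_d).
have [t cyc_t adj_t] := nonbridge_cycle simple_e nb.
by case/negP: nadj_s; apply: (tight_cyc_adj simple_e tight_e cyc_t cyc_s).
Qed.

Lemma tight_only_cycle e s : simple_graph e -> tight e -> pendant_free e ->
  is_cycle e s -> (forall x y, nonbridge e x y -> x \in s) -> cycle_component e s.
Proof.
move=> simple_e tight_e pendfree cyc_s only_s; split=> // x y s_x exy.
have [s_y | s'y] := boolP (y \in s); first exact: (tight_chordless simple_e tight_e).
have [||a [b []]] := no_dead_end_nonbridge simple_e (is_cycle_connected_set cyc_s)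
  (pendant_free_no_dead_end pendfree) _ _ exy; rewrite ?inE //.
by move=> s'a /only_s s_a; rewrite s_a in s'a.
Qed.

(* Deleting the other cycles and all pendant trees isolates the cycle. *)
Lemma tight_isolate_cycle e s : simple_graph e -> tight e -> is_cycle e s ->
  exists f, [/\ simple_graph f, tight f & cycle_component f s].
Proof.
move: e; apply: simple_graph_ind => e simple_e IHe tight_e cyc_s.
have [[a [b /andP[s'a nb]]] | only_s] :=
  rel_witness_or_empty (fun a b => (a \notin s) && nonbridge e a b).
  have [tight_d _ _ _] := tight_del_vertex simple_e tight_e nb.
  have /andP[eab _] := nb; have simple_d := simple_del_vertex a simple_e.
  apply: (IHe _ simple_d (nedges_del_vertex simple_e eab) tight_d).
  exact: is_cycle_del_vertex.
have [pendfree | ] := boolP (pendant_free e).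
  exists e; split=> //; apply: tight_only_cycle => // a b nb.
  by have := only_s a b; rewrite nb andbT negbK.
case/pendant_freePn=> x [y pend_xy].
have [tight_d theta_d] := tight_del_pendant simple_e tight_e pend_xy.
have /pendantP[exy _] := pend_xy; rewrite (simple_sym simple_e) in exy.
have simple_d := simple_del_vertex y simple_e.
apply: (IHe _ simple_d (nedges_del_vertex simple_e exy) tight_d).
apply: is_cycle_del_vertex (cyc_s) _; apply/negP => s_y.
have nb := is_cycle_nonbridge simple_e cyc_s (cyc_adj_next s_y).
by have := theta_del_vertex_nonbridge simple_e nb; rewrite theta_d ltnn.
Qed.

Definition cycle_gap s := [&& ~~ odd (size s), ~~ typeA w s & typeA v s].

Lemma tight_cycle_gap e s : simple_graph e -> tight e -> is_cycle e s -> cycle_gap s.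
Proof.
move=> simple_e tight_e /(tight_isolate_cycle simple_e tight_e).
case=> f [simple_f tight_f comp_s]; have [cyc_s _] := comp_s.
have [x s_x] := is_cycle_inhabited cyc_s.
have nb := is_cycle_nonbridge simple_f cyc_s (cyc_adj_next s_x).
have [_ _ rank_v rank_w] := tight_del_vertex simple_f tight_f nb.
have even_s := gain_rank_drop2_even gain_w simple_f comp_s s_x rank_w.
rewrite /cycle_gap even_s /=; apply/andP; split.
  apply/negP => typeA_w; move: rank_w.
  by rewrite (gain_rank_del_typeA gain_w simple_f comp_s s_x even_s typeA_w); lia.
apply/negPn/negP => not_typeA_v; move: rank_v.
by rewrite (gain_rank_del_not_typeA gain_v simple_f comp_s s_x even_s not_typeA_v); lia.
Qed.

Lemma tight_cycle_packing e : simple_graph e -> tight e ->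
  exists cs, [/\ size cs = theta e, {in cs, forall c, is_cycle e c}, disjoint_seqs cs &
    forall x y, nonbridge e x y -> has (fun c => cyc_adj c x y) cs].
Proof.
move: e; apply: simple_graph_ind => e simple_e IHe tight_e.
have [acyclic_e | /acyclicPn[x [y nb]]] := boolP (acyclic e).
  exists [::]; split=> // [|x y nb]; first by rewrite (tight_acyclic simple_e).
  by rewrite (negbTE (acyclic_bridge x y acyclic_e)) in nb.
have [tight_d theta_e _ _] := tight_del_vertex simple_e tight_e nb.
have [s cyc_s adj_s] := nonbridge_cycle simple_e nb; have s_x := cyc_adj_meml adj_s.
have simple_d := simple_del_vertex x simple_e; have sub_d := @sub_del_vertex _ e x.
have /andP[exy _] := nb.
have [cs [size_cs cyc_cs disj_cs cover_cs]] :=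
  IHe _ simple_d (nedges_del_vertex simple_e exy) tight_d.
exists (s :: cs); split.
- by rewrite /= size_cs theta_e.
- by move=> c; rewrite inE => /predU1P[-> // | /cyc_cs]; apply: sub_is_cycle.
- rewrite /= disj_cs andbT; apply/allP => c cs_c; have cyc_c := cyc_cs c cs_c.
  have c'x := is_cycle_del_vertex_notin cyc_c.
  have cyc_c_e := sub_is_cycle sub_d cyc_c.
  have [eq_adj | //] := tight_cycles_disjoint simple_e tight_e cyc_s cyc_c_e.
  by move: adj_s; rewrite eq_adj => /cyc_adj_meml; rewrite (negbTE c'x).
- move=> a b nb_ab; have [t cyc_t adj_t] := nonbridge_cycle simple_e nb_ab; rewrite /=.
  have [t_x | t'x] := boolP (x \in t).
    by rewrite (tight_meeting_cycles simple_e tight_e cyc_s cyc_t s_x t_x) adj_t.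
  have cyc_t_d := is_cycle_del_vertex cyc_t t'x.
  by rewrite cover_cs ?orbT //; apply: is_cycle_nonbridge adj_t.
Qed.

Lemma tight_two_colouring e : simple_graph e -> tight e ->
  exists col, two_colouring e col.
Proof.
move=> simple_e tight_e; apply: two_colouring_exists => // s cyc_s.
by have /and3P[] := tight_cycle_gap simple_e tight_e cyc_s.
Qed.

(* Deleting [y] lowers [gain_rank v] by 2, so it must preserve tightness and [theta]. *)
Lemma tight_del_bridge_end e x x' y : simple_graph e -> tight e ->
  nonbridge e x x' -> e x y -> ~~ nonbridge e x y ->
  [/\ tight (del_vertex e y), theta (del_vertex e y) = theta e &
      gain_rank w e = (gain_rank w (del_vertex e y)).+2].
Proof.
move=> simple_e tight_e nb exy bridge_xy; have sym_e := simple_sym simple_e.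
have [col col_e] := tight_two_colouring simple_e tight_e.
have [_ _ /(gain_rank_del_vertex_eqP _ _ sym_e)[null_x null_tr_x] _] :=
  tight_del_vertex simple_e tight_e nb.
have gain_tr := is_gain_tr gain_v.
have rank_v : gain_rank v e = (gain_rank v (del_vertex e y)).+2.
  by apply/gain_rank_del_vertex_drop2P => //; split;
    apply: (bridge_null_at_spike_at _ simple_e col_e exy bridge_xy).
have := theta_del_vertex y simple_e; have := gain_rank_del_vertex_ge w e y.
have := gain_rank_le gain_w gain_v (simple_del_vertex y simple_e).
by move: tight_e rank_v; rewrite /tight; split; lia.
Qed.

Lemma tight_pendant_free_nonbridge e a b :
  simple_graph e -> tight e -> pendant_free e -> e a b -> nonbridge e a b.
Proof.
move=> simple_e tight_e pendfree eab; apply/negPn/negP => bridge_ab.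
have [x [y [x' [exy bridge_xy nb]]]] := bridge_at_cycle simple_e pendfree eab bridge_ab.
have [tight_d theta_d rank_w] := tight_del_bridge_end simple_e tight_e nb exy bridge_xy.
have simple_d := simple_del_vertex y simple_e.
have [[z spike_z] _] :=
  (gain_rank_del_vertex_drop2P w y (simple_sym simple_e)).1 rank_w.
have [c [c' [z_c nb_c]]] := spike_support_nonbridge gain_w simple_e pendfree spike_z.
have [s cyc_s adj_s] := nonbridge_cycle simple_e nb_c.
have s'y : y \notin s.
  apply/negP => s_y; have nb_y := is_cycle_nonbridge simple_e cyc_s (cyc_adj_next s_y).
  by have := theta_del_vertex_nonbridge simple_e nb_y; rewrite theta_d ltnn.
have nb_d := is_cycle_nonbridge simple_d (is_cycle_del_vertex cyc_s s'y) adj_s.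
have [_ _ _ rank_d] := tight_del_vertex simple_d tight_d nb_d.
case/eqP: z_c; apply: (gain_rank_del_vertex_drop2_null rank_d).
exact: spike_null_del_vertex.
Qed.

End Tight.

(** * Pendant reductions *)

Section DeltaReduction.
Local Open Scope nat_scope.
Variable n : nat.
Implicit Types (e : rel 'I_n) (S : {set 'I_n}) (x y : 'I_n).

Lemma pendant_inducedE e S x y :
  pendant (induced e S) x y = [&& x \in S, y \in S, e x y & deg_in e S x == 1].
Proof.
apply/pendantP/and4P=> [[/and3P[exy S_x S_y] uniq_nbr] |
                        [S_x S_y exy /cards1P[z nbrs_x]]].
  split=> //; apply/cards1P; exists y; apply/setP => z; rewrite !inE.
  apply/andP/eqP => [[S_z exz] | ->//]; apply: uniq_nbr.
  by rewrite /induced exz S_x.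
have nbr_z a : a \in S -> e x a -> a = z.
  by move=> S_a exa; apply/set1P; rewrite -nbrs_x inE S_a.
split=> [|a /and3P[exa _ S_a]]; first by rewrite /induced exy S_x.
by rewrite (nbr_z a) // (nbr_z y).
Qed.

Lemma delta_stepP e S S' :
  delta_step e S S' <-> exists x y, pendant (induced e S) x y /\ S' = S :\ x :\ y.
Proof.
split=> -[x [y]].
  case=> S_x S_y exy deg_x ->; exists x, y.
  by rewrite pendant_inducedE S_x S_y exy deg_x.
by rewrite pendant_inducedE => -[/and4P[S_x S_y exy /eqP deg_x] ->]; exists x, y.
Qed.

(* The pendant vertex becomes isolated, so only its neighbour needs to be deleted. *)
Lemma induced_delta e S x y : simple_graph e -> pendant (induced e S) x y ->
  induced e (S :\ x :\ y) = del_vertex (induced e S) y.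
Proof.
move=> simple_e /pendantP[_ uniq_nbr].
have sym_S := simple_sym (simple_induced S simple_e).
apply/funeq2P => a b; apply/idP/idP.
  case/and3P=> eab; rewrite !inE => /and3P[a_y _ S_a] /and3P[b_y _ S_b].
  by rewrite /del_vertex /induced eab S_a S_b a_y.
case/and3P=> Sab a_y b_y; have /and3P[eab S_a S_b] := Sab.
have a_x : a != x by apply: contraNneq b_y => a_x; rewrite -(uniq_nbr b) -?a_x.
have b_x : b != x by apply: contraNneq a_y => b_x; rewrite -(uniq_nbr a) -?b_x // sym_S.
by rewrite /induced eab !inE a_y a_x S_a b_y b_x.
Qed.

Lemma no_pendantP e S : no_pendant e S <-> pendant_free (induced e S).
Proof.
split=> [no_pend | /forallP pendfree x S_x deg_x].
  apply/negPn/pendant_freePn => -[x [y]]; rewrite pendant_inducedE.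
  by case/and4P=> S_x _ _ /eqP; apply: no_pend.
have /card_gt0P[y] : 0 < deg_in e S x by rewrite deg_x.
rewrite inE => /andP[S_y exy]; have /forallP/(_ y) := pendfree x.
by rewrite pendant_inducedE S_x S_y exy deg_x.
Qed.

Lemma delta_star_pendant_free e S :
  exists2 S0, delta_star e S S0 & pendant_free (induced e S0).
Proof.
have [k] := ubnP #|S|; elim: k S => // k IHk S lt_S_k.
have [pendfree | /pendant_freePn[x [y pend_xy]]] := boolP (pendant_free (induced e S)).
  by exists S => //; apply: delta_refl.
have [|S0 delta_S0 pendfree] := IHk (S :\ x :\ y).
  have S_x : x \in S by move: pend_xy; rewrite pendant_inducedE => /and4P[].
  rewrite (leq_ltn_trans (subset_leq_card (subsetDl _ _))) //.
  by move: lt_S_k; rewrite (cardsD1 x) S_x.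
by exists S0 => //; apply: delta_next delta_S0; apply/delta_stepP; exists x, y.
Qed.

End DeltaReduction.

Section DeltaReductionRank.
Local Open Scope nat_scope.
Variables (F K : fieldType) (n : nat) (w : 'I_n -> 'I_n -> F) (v : 'I_n -> 'I_n -> K).
Variable e : rel 'I_n.
Hypotheses (gain_w : is_gain w) (gain_v : is_gain v) (simple_e : simple_graph e).
Implicit Types S : {set 'I_n}.

Lemma delta_star_tight S S0 : delta_star e S S0 -> tight w v (induced e S) ->
  tight w v (induced e S0) /\ theta (induced e S0) = theta (induced e S).
Proof.
elim=> {S S0} [S tight_S | S S' S0 /delta_stepP[x [y [pend_xy ->]]] _ IHS tight_S].
  by split.
have [] := tight_del_pendant gain_w gain_v (simple_induced S simple_e) tight_S pend_xy.
rewrite -(induced_delta simple_e pend_xy) => tight_S' <-; exact: IHS tight_S'.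
Qed.

Lemma delta_star_gain_rank S S0 : delta_star e S S0 ->
  gain_rank w (induced e S) + gain_rank v (induced e S0) =
  gain_rank v (induced e S) + gain_rank w (induced e S0).
Proof.
elim=> {S S0} [S | S S' S0 /delta_stepP[x [y [pend_xy ->]]] _]; first by rewrite addnC.
have simple_S := simple_induced S simple_e; rewrite (induced_delta simple_e pend_xy).
rewrite (gain_rank_pendant simple_S gain_w pend_xy).
by rewrite (gain_rank_pendant simple_S gain_v pend_xy); lia.
Qed.

End DeltaReductionRank.

(** * Characterization of the equality case *)

Section EqualityCase.
Local Open Scope nat_scope.
Variables (F K : fieldType) (n : nat) (w : 'I_n -> 'I_n -> F) (v : 'I_n -> 'I_n -> K).
Hypotheses (gain_w : is_gain w) (gain_v : is_gain v).
Implicit Types (e : rel 'I_n) (s : seq 'I_n) (cs : seq (seq 'I_n)).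

Lemma gain_rank_cycle_components e cs : simple_graph e -> theta e <= size cs ->
  disjoint_seqs cs -> {in cs, forall c, cycle_component e c /\ cycle_gap w v c} ->
  gain_rank w e = gain_rank v e + 2 * size cs.
Proof.
elim: cs e => [|c cs IHcs] e simple_e.
  rewrite leqn0 muln0 addn0 => /eqP theta_e _ _; apply: gain_rank_acyclic => //.
  apply/negPn/acyclicPn => -[x [y nb]].
  by have := theta_gt0 simple_e nb; rewrite theta_e.
move=> theta_e /= /andP[/allP disj_c disj_cs] comp_cs.
have [comp_c /and3P[even_c not_typeA_w typeA_v]] := comp_cs c (mem_head _ _).
have [cyc_c _] := comp_c; have [x c_x] := is_cycle_inhabited cyc_c.
have nb := is_cycle_nonbridge simple_e cyc_c (cyc_adj_next c_x).
rewrite (gain_rank_del_not_typeA gain_w simple_e comp_c c_x even_c not_typeA_w).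
rewrite -(gain_rank_del_typeA gain_v simple_e comp_c c_x even_c typeA_v).
rewrite (IHcs (del_vertex e x)) //; first by lia.
- exact: simple_del_vertex.
- by rewrite -ltnS (leq_trans (theta_del_vertex_nonbridge simple_e nb)).
move=> t cs_t; have [|comp_t gap_t] := comp_cs t; first by rewrite inE cs_t orbT.
split=> //; apply: cycle_component_del_vertex => //.
by rewrite (disjointFr (disj_c t cs_t)).
Qed.

Definition reduces_to_cycles e := exists S0 : {set 'I_n}, exists cs : seq (seq 'I_n),
  [/\ delta_star e [set: 'I_n] S0 /\ no_pendant e S0,
      size cs = theta e,
      (forall c, c \in cs -> is_cycle e c /\ {subset c <= S0}),
      (forall i j, i < size cs -> j < size cs -> i <> j ->
         forall x, x \in nth [::] cs i -> x \notin nth [::] cs j) &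
      (forall x y, x \in S0 -> y \in S0 -> e x y = has (fun c => cyc_adj c x y) cs)].

Lemma tight_reduces_to_cycles e : simple_graph e -> tight w v e -> reduces_to_cycles e.
Proof.
move=> simple_e tight_e.
have [S0 delta_S0 pendfree] := delta_star_pendant_free e [set: 'I_n].
have := delta_star_tight gain_w gain_v simple_e delta_S0.
rewrite induced_setT => /(_ tight_e)[tight_S0 theta_S0].
have simple_S0 := simple_induced S0 simple_e.
have [cs [size_cs cyc_cs disj_cs cover_cs]] :=
  tight_cycle_packing gain_w gain_v simple_S0 tight_S0.
exists S0, cs; split.
- split; [exact: delta_S0 | exact/no_pendantP].
- rewrite size_cs; exact: theta_S0.
- move=> c /cyc_cs cyc_c; split; first exact: sub_is_cycle (@sub_induced _ _ _) cyc_c.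
  by move=> x /(is_cycle_next cyc_c)/and3P[].
- exact/disjoint_seqsP.
- move=> x y S0_x S0_y; apply/idP/idP => [exy | /hasP[c /cyc_cs cyc_c adj_c]].
    apply: cover_cs.
    apply: (tight_pendant_free_nonbridge gain_w gain_v simple_S0 tight_S0 pendfree).
    by rewrite /induced exy S0_x.
  exact: sub_induced (cyc_adj_edge simple_S0 cyc_c adj_c).
Qed.

Lemma reduces_to_cycles_tight e : simple_graph e ->
  (forall s, is_cycle e s -> cycle_gap w v s) -> reduces_to_cycles e -> tight w v e.
Proof.
move=> simple_e gap_e [S0 [cs [[delta_S0 _] size_cs cyc_cs disj_cs adj_cs]]].
have simple_S0 := simple_induced S0 simple_e.
move/disjoint_seqsP: disj_cs => disj_cs.
have := delta_star_gain_rank gain_w gain_v simple_e delta_S0; rewrite induced_setT.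
rewrite (@gain_rank_cycle_components (induced e S0) cs) //.
- by rewrite /tight size_cs; lia.
- by rewrite size_cs; apply: theta_sub (@sub_induced _ _ _).
move=> c cs_c; have [cyc_c sub_c] := cyc_cs c cs_c; split; last exact: gap_e.
split; first exact: is_cycle_induced.
move=> x y c_x /and3P[exy S0_x S0_y]; move: exy; rewrite adj_cs //.
case/hasP=> c' cs_c' adj_c'.
by rewrite (disjoint_seqs_meet disj_cs cs_c cs_c' c_x (cyc_adj_meml adj_c')).
Qed.

Definition cycles_disjoint e := forall s t, is_cycle e s -> is_cycle e t ->
  (forall x y, cyc_adj s x y = cyc_adj t x y) \/ (forall x, x \in s -> x \notin t).

Theorem tightP e : simple_graph e ->
  tight w v e <->
  [/\ cycles_disjoint e, forall s, is_cycle e s -> cycle_gap w v s &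
      reduces_to_cycles e].
Proof.
move=> simple_e; split=> [tight_e | [_ gap_e]]; last exact: reduces_to_cycles_tight.
split; last exact: tight_reduces_to_cycles.
  move=> s t cyc_s cyc_t.
  have [|disj_st] := tight_cycles_disjoint gain_w gain_v simple_e tight_e cyc_s cyc_t.
    by left.
  by right=> x s_x; rewrite (disjointFr disj_st s_x).
by move=> s; apply: (tight_cycle_gap gain_w gain_v simple_e tight_e).
Qed.

End EqualityCase.

Section UnitGain.
Variables (R : realType) (n : nat) (e : rel 'I_n) (phi : 'I_n -> 'I_n -> R[i]).
Hypotheses (simple_e : simple_graph e) (gain_phi : unit_gain e phi).
Implicit Types s : seq 'I_n.

Definition extend_gain (x y : 'I_n) : R[i] := if e x y then phi x y else 1.

Lemma is_gain_extend : is_gain extend_gain.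
Proof.
move=> x y; rewrite /extend_gain (simple_sym simple_e y x).
case: ifP => [exy | _]; last by rewrite mulr1.
by have [norm1 ->] := gain_phi exy; rewrite -normCK norm1 expr1n.
Qed.

Lemma rank_gain_adj : \rank (gain_adj e phi) = gain_rank extend_gain e.
Proof.
by congr (\rank _); apply/matrixP => i j; rewrite !mxE /extend_gain; case: ifP.
Qed.

Lemma cgain_extend s : is_cycle e s -> cgain extend_gain s = cycle_gain phi s.
Proof.
move=> cyc_s; apply: eq_big_seq => x s_x.
by rewrite /extend_gain (is_cycle_next cyc_s s_x).
Qed.

Lemma cycle_gap_extend s : is_cycle e s ->
  cycle_gap extend_gain (fun _ _ => 1 : R) s <-> typeB phi s /\ (size s %% 4 = 0)%N.
Proof.
move=> cyc_s; rewrite /cycle_gap /typeA cgain_extend // cgain1 /typeB.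
have -> : (1 == (-1) ^+ (size s)./2 :> R) = ~~ odd (size s)./2.
  rewrite -signr_odd; case: (odd _); last by rewrite eqxx.
  by rewrite expr1 -subr_eq0 opprK -mulr2n pnatr_eq0.
split=> [/and3P[even_s /eqP typeB_s even_half] | [[even_s /eqP typeB_s] size_s]].
  by split=> //; move: even_s even_half; lia.
by rewrite even_s typeB_s /=; move: even_s size_s; lia.
Qed.

End UnitGain.

Theorem theorem4p9 (R : realType) (n : nat) (e : rel 'I_n)
  (phi : 'I_n -> 'I_n -> R[i]) :
  simple_graph e -> unit_gain e phi ->
  (\rank (gain_adj e phi) = \rank (adj01 R e) + 2 * theta e)%N
  <->
  [/\ (* (i) cycles pairwise vertex-disjoint *)
      (forall s t, is_cycle e s -> is_cycle e t ->
         (forall x y, cyc_adj s x y = cyc_adj t x y) \/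
         (forall x, x \in s -> x \notin t)),
      (* (ii) every cycle is of Type B with order divisible by 4 *)
      (forall s, is_cycle e s -> typeB phi s /\ (size s %% 4 = 0)%N) &
      (* (iii) delta-transformations reach a crucial subgraph G0 which is
         the disjoint union of theta(G) cycles and isolated vertices *)
      (exists S0 : {set 'I_n}, exists cs : seq (seq 'I_n),
         [/\ delta_star e [set: 'I_n] S0 /\ no_pendant e S0,
             size cs = theta e,
             (forall c, c \in cs -> is_cycle e c /\ {subset c <= S0}),
             (forall i j, (i < size cs)%N -> (j < size cs)%N -> i <> j ->
                forall x, x \in nth [::] cs i -> x \notin nth [::] cs j) &
             (forall x y, x \in S0 -> y \in S0 ->
                e x y = has (fun c => cyc_adj c x y) cs)])].
Proof.
move=> simple_e gain_phi; have gain_w := is_gain_extend simple_e gain_phi.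
rewrite rank_gain_adj -[\rank (adj01 R e)]/(gain_rank (fun _ _ => 1) e).
apply: iff_trans (tightP gain_w (@is_gain1 R n) simple_e) _.
split=> -[disj_e gap_e red_e]; (split; [exact: disj_e | move=> s cyc_s | exact: red_e]).
  exact/(cycle_gap_extend phi cyc_s)/gap_e.
exact/(cycle_gap_extend phi cyc_s)/gap_e.
Qed.
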